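(* (i) Let $\mathscr{C}\subset[0,1]$ be the Cantor set generated by an iterated function system $\{\phi_i:[0,1]\to[0,1] : i\in\mathcal I\}$ all of whose maps $\phi_i$ are (restrictions to $[0,1]$ of) real polynomials. Then $$\Delta(\mathscr{C},\varepsilon)\preccurlyeq \log(\varepsilon^{-1}),$$ i.e. there is a constant $C>0$ (possibly depending on the system) such that $\Delta(\mathscr{C},\varepsilon)\le C\log(\varepsilon^{-1})$ for all sufficiently small $\varepsilon>0$. (ii) For every $\delta>0$ there exist iterated function systems on $[0,1]$ consisting of polynomial maps such that the generated Cantor set $\mathscr{C}$ satisfies $$(1-\delta)\log(\varepsilon^{-1})\le \Delta(\mathscr{C},\varepsilon)$$ for all sufficiently small $\varepsilon>0$.
   Context: Complexity. Fix a universal Turing machine $U$. A program is a finite binary word $\mathtt P\in\{0,1\}^*$ run on $U$, with length $\ell(\mathtt P)$; when it halts, its output is read (in a fixed standard encoding, e.g. as a finite list of points with rational coordinates) as a finite set $\mathtt C(\mathtt P)\subset\mathbb R$. For a compact set $\mathscr{C}\subset\mathbb R$ and $\varepsilon>0$, the $\varepsilon$-distortion complexity is $$\Delta(\mathscr{C},\varepsilon)=\min\{\ell(\mathtt P) : d_{\mathrm H}(\mathtt C(\mathtt P),\mathscr{C})<\varepsilon\},$$ where the minimum is over programs producing a finite set and $d_{\mathrm H}$ is the Hausdorff distance, $d_{\mathrm H}(F_1,F_2)=\max\{\sup_{x\in F_2}d(x,F_1),\sup_{x\in F_1}d(x,F_2)\}$. Here $\log$ is the base-2 logarithm. Iterated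 function systems. Let $A=[0,1]$ and let $\mathcal I$ be a finite index set with at least two elements. An iterated function system (IFS) is a collection $\{\phi_i:A\to A : i\in\mathcal I\}$ of injective contractions with a uniform contraction rate $\rho\in(0,1)$ (i.e. $|\phi_i(x)-\phi_i(y)|\le\rho|x-y|$ for all $i$) such that $\phi_i(A)\cap\phi_j(A)=\emptyset$ for $i\ne j$. The Cantor set generated by the IFS is the unique nonempty compact set $\mathscr{C}\subset A$ with $\mathscr{C}=\bigcup_{i\in\mathcal I}\phi_i(\mathscr{C})$; equivalently the set of points $\bigcap_{n}\phi_{\omega_1}\circ\cdots\circ\phi_{\omega_n}(A)$, $\omega\in\mathcal I^{\infty}$. *)

(* Defs.v *)
From HB Require Import structures.
From mathcomp Require Import all_boot all_order all_algebra.
From mathcomp Require Import all_classical all_reals all_analysis.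

Set Implicit Arguments.
Unset Strict Implicit.
Unset Printing Implicit Defensive.

Import Order.TTheory GRing.Theory Num.Theory.
Import numFieldNormedType.Exports.

Local Open Scope classical_set_scope.
Local Open Scope ring_scope.

Inductive move := MoveLeft | Stay | MoveRight.

(* Deterministic Turing machines with finitely many two-way infinite tapes,
   numbered 0, ..., extra_tapes.  The tape alphabet consists of the blank
   [None], the two bits [Some (inl b)] and auxiliary symbols [Some (inr a)].
   The transition function returns [None] when the machine halts. *)
Record turing_machine := TuringMachine {
  state : finType;
  aux_symbol : finType;
  extra_tapes : nat;
  start : state;
  trans :
    state ->
    {ffun 'I_extra_tapes.+1 -> option (bool + aux_symbol)} ->
    option (state *
            ('I_extra_tapes.+1 -> option (bool + aux_symbol) * move)) }.

Definition symbol (M : turing_machine) : Type :=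
  option (bool + aux_symbol M).

(* [lhs] lists the cells to the left of the head, nearest first; [rhs] lists
   the scanned cell and those to its right; all the other cells are blank. *)
Record tape (G : Type) := Tape { lhs : seq (option G); rhs : seq (option G) }.

Section Tapes.
Variable G : Type.
Implicit Types (t : tape G) (a : option G).

Definition scanned t : option G := head None (rhs t).

Definition write a t : tape G := Tape (lhs t) (a :: behead (rhs t)).

Definition shift (m : move) t : tape G :=
  match m with
  | MoveLeft => Tape (behead (lhs t)) (head None (lhs t) :: rhs t)
  | Stay => t
  | MoveRight => Tape (scanned t :: lhs t) (behead (rhs t))
  end.

End Tapes.

Section Computation.
Variable M : turing_machine.

Definition config : Type :=
  state M * ('I_(extra_tapes M).+1 -> tape (bool + aux_symbol M)).

Definition step (c : config) : option config :=
  if trans c.1 [ffun i => scanned (c.2 i)] is Some (q, act) then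
    Some (q, fun i => shift (act i).2 (write (act i).1 (c.2 i)))
  else None.

(* The input word is on tape 0, with its first bit scanned. *)
Definition initial (w : seq bool) : config :=
  (start M, fun i => Tape [::] (if i == ord0
                                then [seq Some (inl b) | b <- w] else [::])).

Fixpoint leading_bits (s : seq (symbol M)) : seq bool :=
  if s is Some (inl b) :: s' then b :: leading_bits s' else [::].

(* The output is the longest word of bits that can be read on tape 0, from
   the head rightwards, when the machine halts. *)
Definition output (c : config) : seq bool := leading_bits (rhs (c.2 ord0)).

Definition computes (w v : seq bool) : Prop :=
  exists (n : nat) (c : config),
    [/\ iter n (obind step) (Some (initial w)) = Some c,
        step c = None & output c = v].

End Computation.

(* [U] simulates every machine [M], the description of [M] being a prefix [p]
   of the input; in particular [U] diverges on [p ++ w] iff [M] diverges on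
   [w]. *)
Definition universal (U : turing_machine) : Prop :=
  forall M : turing_machine, exists p : seq bool,
    forall w v : seq bool, computes M w v <-> computes U (p ++ w) v.

(* [(s, m, n)] stands for the rational number (-1)^s m / (n + 1).  It is
   written as a sign bit followed by [m] and [n] in unary, both terminated
   by 0; only the length of programs matters, not that of their outputs. *)
Definition point_code : Type := bool * nat * nat.

Definition point_word (x : point_code) : seq bool :=
  let: (s, m, n) := x in
  s :: nseq m true ++ false :: nseq n true ++ [:: false].

Definition list_word (l : seq point_code) : seq bool :=
  flatten [seq point_word x | x <- l].

Definition point_value (x : point_code) : rat :=
  let: (s, m, n) := x in (-1) ^+ s * m%:R / n.+1%:R.

Lemma point_word_inj (x y : point_code) (v w : seq bool) :
  point_word x ++ v = point_word y ++ w -> x = y /\ v = w.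
Proof.
have unary (m n : nat) (a b : seq bool) :
    nseq m true ++ false :: a = nseq n true ++ false :: b -> m = n /\ a = b.
  elim: m n => [|m IHm] [|n] //=; first by case.
  by case=> /IHm [-> ->].
case: x y => [[s m] n] [[s' m'] n'] /=; rewrite -!catA /= -!catA /=.
by case=> -> /unary[-> /unary[-> ->]].
Qed.

Lemma list_word_inj : injective list_word.
Proof.
rewrite /list_word; elim=> [|x l IHl] [|y k] //=.
- by case: y => [[s m] n].
- by case: x => [[s m] n].
- by case/point_word_inj=> -> /IHl ->.
Qed.

Section Complexity.
Variable R : realType.

(* [F] is the finite set C(P) produced by the program [P]. *)
Definition produces (U : turing_machine) (P : seq bool) (F : set R) : Prop :=
  exists2 l : seq point_code, computes U P (list_word l) &
    F = [set ratr (point_value x) | x in [set` l]].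

Lemma edist_normE (x y : R) : edist (x, y) = `|x - y|%:E.
Proof.
rewrite /edist -ball_normE /= ereal_inf_EFin; last 2 first.
- by exists 0 => r [/ltW].
- exists (`|x - y| + 1); split; last by rewrite /ball_/= ltrDl.
  by rewrite ltr_wpDl.
congr EFin; apply/eqP; rewrite eq_le; apply/andP; split; last first.
  apply: lb_le_inf; last by move=> r [_ /ltW].
  exists (`|x - y| + 1); split; last by rewrite /ball_/= ltrDl.
  by rewrite ltr_wpDl.
apply/ler_addgt0Pr => e e0; apply: ge_inf; first by exists 0 => r [/ltW].
by split; [rewrite ltr_wpDl|rewrite /ball_/= ltrDl].
Qed.

(* The distance to the empty set is +oo, hence so is the Hausdorff distance
   of a nonempty set to the empty set. *)
Definition hausdorff_dist (F1 F2 : set R) : \bar R :=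
  maxe (ereal_sup [set edist_inf F1 x | x in F2])
       (ereal_sup [set edist_inf F2 x | x in F1]).

(* An infimum of natural numbers: it is attained unless the set of programs
   is empty, in which case it is +oo. *)
Definition distortion_complexity (U : turing_machine) (S : set R) (eps : R)
    : \bar R :=
  ereal_inf [set (size P)%:R%:E | P in
    [set P : seq bool | exists2 F : set R,
      produces U P F & (hausdorff_dist F S < eps%:E)%E]].

Definition log2 (x : R) : R := ln x / ln 2.

End Complexity.

Section IteratedFunctionSystems.
Variables (R : realType) (I : finType).
Implicit Types (phi : I -> R -> R) (C : set R).

Definition is_ifs phi : Prop :=
  [/\ (1 < #|I|)%N,
      forall i, set_fun `[0, 1] `[0, 1] (phi i),
      forall i, set_inj `[0, 1] (phi i),
      exists2 rho : R, 0 < rho < 1 &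
        forall i x y, x \in `[0, 1] -> y \in `[0, 1] ->
          `|phi i x - phi i y| <= rho * `|x - y|
    & trivIset [set: I] (fun i => phi i @` `[0, 1])].

Definition polynomial_system phi : Prop :=
  forall i, exists p : {poly R},
    forall x, x \in `[0, 1] -> phi i x = p.[x].

(* By Hutchinson's theorem there is exactly one such set if [is_ifs phi]. *)
Definition generated_by phi C : Prop :=
  [/\ C !=set0, compact C, C `<=` `[0, 1] &
      C = \bigcup_(i in [set: I]) (phi i @` C)].

End IteratedFunctionSystems.

(* Main.v *)
Require Import Defs.
From HB Require Import structures.
From mathcomp Require Import all_boot all_order all_algebra.
From mathcomp Require Import all_classical all_reals all_analysis.
From mathcomp Require Import zify ring lra.

Set Implicit Arguments.
Unset Strict Implicit.
Unset Printing Implicit Defensive.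

Import Order.TTheory GRing.Theory Num.Theory.
Import numFieldNormedType.Exports.

Local Open Scope classical_set_scope.
Local Open Scope ring_scope.

(* Upper bound.  Truncate the coefficients of the maps to m = log(1/eps) + O(1)
   bits.  A fixed machine that reads these O(m) bits evaluates all compositions
   of k = O(m) maps at 0 in fixed-point arithmetic: one evaluation is off by
   O(2^-m), the contraction sums the errors of a whole orbit to O(2^-m), and
   replacing the attractor by 0 costs rho^k <= 2^-m.  Running times being
   irrelevant, the machine is obtained by compiling loop programs on unary
   registers, which compute all primitive recursive functions.

   Lower bound.  The largest point of the attractor of x/4 and x/4 + 3t/4 is t,
   so a program whose output is 2^-n-close to the attractor determines t up to
   an error 2 * 2^-n.  There are O(2^((1-delta)n)) programs of length at most
   (1-delta)n, hence the bad parameters at scale n have measure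
   O(2^(-delta n)), which is summable, and some t is good at all fine scales. *)

(** * Compiling stack programs to Turing machines *)

Section StackPrograms.
Local Open Scope nat_scope.

(** Each stack becomes a tape whose head scans the top bit. Loops test for a top bit [true]; an
    empty stack counts as [false]. *)
Inductive cmd :=
  | Push of nat & bool
  | Pop of nat
  | Seq of cmd & cmd
  | While of nat & cmd.

Definition store := nat -> seq bool.

Definition upd T (s : nat -> T) (i : nat) (x : T) : nat -> T :=
  fun j => if j == i then x else s j.

Inductive exec : cmd -> store -> store -> Prop :=
  | exec_push i b s : exec (Push i b) s (upd s i (b :: s i))
  | exec_pop i s b r : s i = b :: r -> exec (Pop i) s (upd s i r)
  | exec_seq a c s s' s'' :
      exec a s s' -> exec c s' s'' -> exec (Seq a c) s s''
  | exec_stop i c s : head false (s i) = false -> exec (While i c) s s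
  | exec_loop i c s s' s'' : head false (s i) ->
      exec c s s' -> exec (While i c) s' s'' -> exec (While i c) s s''.

(** [ITest i l] falls through if the top of stack [i] is [true] and jumps to [l] otherwise. *)
Inductive instr :=
  | IPush of nat & bool
  | IPop of nat
  | ITest of nat & nat
  | IGoto of nat.

Fixpoint csize (c : cmd) : nat :=
  match c with
  | Push _ _ | Pop _ => 1
  | Seq a b => csize a + csize b
  | While _ a => (csize a).+2
  end.

(** Jump targets are absolute, hence the address [off] of the first instruction. *)
Fixpoint compile (off : nat) (c : cmd) : seq instr :=
  match c with
  | Push i b => [:: IPush i b]
  | Pop i => [:: IPop i]
  | Seq a b => compile off a ++ compile (off + csize a) b
  | While i a => ITest i (off + (csize a).+2)
      :: compile off.+1 a ++ [:: IGoto off]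
  end.

Lemma size_compile off c : size (compile off c) = csize c.
Proof.
elim: c off => //= [a IHa b IHb|i a IHa] off; first by rewrite size_cat IHa IHb.
by rewrite size_cat IHa addn1.
Qed.

Fixpoint bounded (k : nat) (c : cmd) : bool :=
  match c with
  | Push i _ | Pop i => i <= k
  | Seq a b => bounded k a && bounded k b
  | While i a => (i <= k) && bounded k a
  end.

Lemma boundedW k l c : k <= l -> bounded k c -> bounded l c.
Proof.
move=> kl; elim: c => [i b|i|a IHa b IHb|i a IHa] /=.
- by move=> /leq_trans; apply.
- by move=> /leq_trans; apply.
- by move=> /andP[/IHa -> /IHb ->].
- by move=> /andP[/leq_trans/(_ kl)-> /IHa->].
Qed.

Lemma bounded_ex c : exists k, bounded k c.
Proof.
elim: c => [i b|i|a [k ka] b [l lb]|i a [k ka]]; 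
  [by exists i => /=|by exists i => /=| |].
- exists (maxn k l) => /=.
  by rewrite (boundedW (leq_maxl k l) ka) (boundedW (leq_maxr k l) lb).
- by exists (maxn i k); rewrite /= leq_maxl (boundedW (leq_maxr i k) ka).
Qed.

Variables (code : seq instr) (ntapes : nat).

(* A push takes two steps, the boolean in the state telling them apart. *)
Definition stack_trans (q : 'I_(size code).+1 * bool)
    (a : {ffun 'I_ntapes.+1 -> option (bool + void)}) :
    option (('I_(size code).+1 * bool) *
            ('I_ntapes.+1 -> option (bool + void) * move)) :=
  match onth code q.1 with
  | Some (IPush i b) =>
      if q.2 then Some ((inord q.1.+1, false),
        fun j : 'I_ntapes.+1 => (if j == i :> nat then Some (inl b) else a j, Stay))
      else Some ((q.1, true),
        fun j : 'I_ntapes.+1 => (a j, if j == i :> nat then MoveLeft else Stay))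
  | Some (IPop i) => Some ((inord q.1.+1, false),
        fun j : 'I_ntapes.+1 => (a j, if j == i :> nat then MoveRight else Stay))
  | Some (ITest i l) =>
      Some ((inord (if a (inord i) == Some (inl true) then q.1.+1 else l),
             false), fun j : 'I_ntapes.+1 => (a j, Stay))
  | Some (IGoto l) => Some ((inord l, false), fun j : 'I_ntapes.+1 => (a j, Stay))
  | None => None
  end.

Definition stack_machine : turing_machine :=
  @TuringMachine ('I_(size code).+1 * bool)%type void ntapes
    (inord 0, false) stack_trans.

Notation M := stack_machine.

Definition reach (c c' : config M) : Prop :=
  exists n, iter n (obind (@step M)) (Some c) = Some c'.

Lemma reach_trans c1 c2 c3 : reach c1 c2 -> reach c2 c3 -> reach c1 c3.
Proof. by move=> [n en] [p ep]; exists (p + n); rewrite iterD en. Qed.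

Lemma reach_step c1 c2 : step c1 = Some c2 -> reach c1 c2.
Proof. by exists 1. Qed.

(** Only the bits from the head to the first non-bit count: popped bits stay to the left of the
    head, where later pushes overwrite them. *)
Definition rep (s : store) (t : 'I_ntapes.+1 -> tape (bool + void)) : Prop :=
  forall i, @leading_bits M (rhs (t i)) = s i.

Definition at_pc (c : config M) (pc : nat) (s : store) : Prop :=
  c.1 = (inord pc, false) /\ rep s c.2.

Lemma scanned_true (t : tape (bool + void)) :
  (scanned t == Some (inl true)) = head false (@leading_bits M (rhs t)).
Proof. by case: t => l [|[[[]|[]]|] r]. Qed.

(** Induction on the derivation rather than on the command, since a loop recurs as itself. The
    surrounding code is arbitrary, so that the induction hypotheses apply to subcommands in
    place. *)
Lemma exec_compile c s s' pre post cfg :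
    exec c s s' -> bounded ntapes c ->
    code = pre ++ compile (size pre) c ++ post -> at_pc cfg (size pre) s ->
  exists2 cfg', reach cfg cfg' & at_pc cfg' (size pre + csize c) s'.
Proof.
move=> ex; elim: ex pre post cfg => {c s s'}.
- move=> i b s pre post [q t] /= ib cE [/= -> rt].
  have pcl : size pre < (size code).+1 by rewrite cE size_cat; lia.
  have oE : onth code (size pre) = Some (IPush i b).
    by rewrite cE onth_cat ltnn subnn.
  eexists; first apply: reach_trans.
  + by apply: reach_step; rewrite /step /= /stack_trans /= inordK // oE.
  + by apply: reach_step; rewrite /step /= /stack_trans /= inordK // oE.
  split => /=; first by rewrite addn1 ?inordK.
  move=> j /=; rewrite !ffunE /upd.
  case: eqP => ji /=; last first.
    by rewrite -rt; case: (t j) => l [].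
  by rewrite -ji -rt; congr cons; case: (t j) => l [].
- move=> i s b r sb pre post [q t] /= ib cE [/= -> rt].
  have pcl : size pre < (size code).+1 by rewrite cE size_cat; lia.
  have oE : onth code (size pre) = Some (IPop i).
    by rewrite cE onth_cat ltnn subnn.
  eexists.
    by apply: reach_step; rewrite /step /= /stack_trans /= inordK // oE.
  split => /=; first by rewrite addn1 ?inordK.
  move=> j /=; rewrite ?ffunE /upd.
  case: eqP => ji /=; last by rewrite -rt; case: (t j) => l [].
  have := rt j; rewrite ji sb; case: (t j) => l [|[[x|[]]|] y] //= [].
  by [].
- move=> a c s s' s'' _ IHa _ IHc pre post cfg /= /andP[ba bc] cE at0.
  have [|cfg1 r1 at1] :=
      IHa pre (compile (size pre + csize a) c ++ post) cfg ba _ at0.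
    by rewrite cE -catA.
  have [|//|cfg2 r2 at2] :=
      IHc (pre ++ compile (size pre) a) post cfg1 bc _ _.
  + by rewrite size_cat size_compile cE -!catA.
  + by rewrite size_cat size_compile.
  exists cfg2; first exact: reach_trans r1 r2.
  by move: at2; rewrite size_cat size_compile -addnA.
- move=> i c s si pre post [q t] /= /andP[ib bc] cE [/= -> rt].
  have pcl : size pre < (size code).+1 by rewrite cE size_cat; lia.
  have oE : onth code (size pre) = Some (ITest i (size pre + (csize c).+2)).
    by rewrite cE onth_cat ltnn subnn.
  eexists.
    by apply: reach_step; rewrite /step /= /stack_trans /= inordK // oE.
  split => /=; last by move=> j; rewrite /= ffunE -rt; case: (t j) => l [].
  by rewrite ffunE scanned_true rt inordK ?si.
- move=> i c s s' s'' si _ IHc _ IHw pre post [q t] /= /andP[ib bc] cE [/= -> rt].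
  have pcl : size pre < (size code).+1 by rewrite cE size_cat; lia.
  have oE : onth code (size pre) = Some (ITest i (size pre + (csize c).+2)).
    by rewrite cE onth_cat ltnn subnn.
  set cfg1 : config M := (inord (size pre).+1, false,
    fun j => write (scanned (t j)) (t j)).
  have r1 : reach (inord (size pre), false, t) cfg1.
    apply: reach_step; rewrite /step /= /stack_trans /= inordK // oE /=.
    rewrite ffunE scanned_true rt inordK // si; congr (Some (_, _)).
    by apply/funext => j; rewrite ffunE.
  have [||cfg2 r2 at2] := IHc (rcons pre (ITest i (size pre + (csize c).+2)))
     ([:: IGoto (size pre)] ++ post) cfg1 bc.
  + by rewrite size_rcons cE cat_rcons -catA.
  + split => /=; first by rewrite size_rcons.
    by move=> j; rewrite -rt; case: (t j) => l [].
  case: cfg2 r2 at2 => q2 t2 r2 [/= q2E rt2].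
  have pc2 : (size pre + (csize c).+1 < size code).
    by rewrite cE !size_cat /= !size_cat size_compile /=; lia.
  set cfg3 : config M := (inord (size pre), false,
    fun j => write (scanned (t2 j)) (t2 j)).
  have r3 : reach (q2, t2) cfg3.
    have oE2 : onth code ((size pre).+1 + csize c) = Some (IGoto (size pre)).
      rewrite cE onth_cat ltnNge addSnnS leq_addr /= addKn /= onth_cat.
      rewrite size_cat size_compile /= addn1 ltnSn.
      by rewrite onth_cat size_compile ltnn subnn.
    apply: reach_step; rewrite q2E /step /= /stack_trans /= size_rcons.
    rewrite inordK; last lia.
    rewrite oE2.
    by congr (Some (_, _)); apply/funext => j; rewrite ffunE.
  have bw : bounded ntapes (While i c) by rewrite /= ib bc.
  have [|cfg4 r4 at4] := IHw pre post cfg3 bw cE.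
    split; first by [].
    by move=> j; rewrite -rt2 /=; case: (t2 j) => l [].
  exists cfg4 => //.
  by apply: reach_trans r4; apply: reach_trans r3; apply: reach_trans r2.
Qed.

End StackPrograms.

(** The program counter ends just past the code, where no instruction is found and the machine
    halts. *)
Lemma exec_computes (c : cmd) : exists M : turing_machine,
  forall w s, exec c (upd (fun=> [::]) 0%N w) s -> computes M w (s 0%N).
Proof.
have [k kc] := bounded_ex c.
exists (stack_machine (compile 0 c) k) => w s ex.
have [||cfg [n rn] [pcE rs]] := @exec_compile (compile 0 c) k c _ s [::] [::]
  (initial _ w) ex kc.
- by rewrite cats0.
- split => // i /=; rewrite /upd -val_eqE /=.
  by case: eqP => // _; elim: w {ex} => //= b w ->.
exists n, cfg; split => //; last exact: rs.
rewrite /step pcE /= /stack_trans /= inordK ?size_compile // onth_default //.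
by rewrite size_compile.
Qed.

(** * Primitive recursive functions on unary registers *)

Ltac upd_cases :=
  rewrite /upd; repeat (case: eqP => /= [?|?]); subst => //=; try lia.

Section RegisterPrograms.
Local Open Scope nat_scope.
Implicit Types (e rho : nat -> nat) (io w : seq bool) (r k : nat).

(* Stack 0 is the input and output word; stack [i.+1] holds the value of
   register [i] in unary. *)
Definition regs io e : store :=
  fun i => if i is j.+1 then nseq (e j) true else io.

Lemma upd_eq T (e : nat -> T) i x : upd e i x i = x.
Proof. by rewrite /upd eqxx. Qed.

Lemma upd_neq T (e : nat -> T) i j x : j != i -> upd e i x j = e j.
Proof. by rewrite /upd => /negbTE ->. Qed.

Lemma upd_id T (e : nat -> T) i x : e i = x -> upd e i x = e.
Proof. by move=> eix; apply/funext => j; rewrite /upd; case: eqP => // ->. Qed.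

Lemma upd_upd T (e : nat -> T) i x y : upd (upd e i x) i y = upd e i y.
Proof. by apply/funext => j; rewrite /upd; case: eqP. Qed.

Lemma exec_inc r io e :
  exec (Push r.+1 true) (regs io e) (regs io (upd e r (e r).+1)).
Proof.
suff <- : upd (regs io e) r.+1 (true :: regs io e r.+1) =
    regs io (upd e r (e r).+1) by exact: exec_push.
by apply/funext => -[|j] //=; rewrite /upd eqSS; case: eqP => // ->.
Qed.

Lemma exec_dec r n io e : e r = n.+1 ->
  exec (Pop r.+1) (regs io e) (regs io (upd e r n)).
Proof.
move=> ern; suff <- : upd (regs io e) r.+1 (nseq n true) = regs io (upd e r n).
  by apply: exec_pop; rewrite /= ern /=.
by apply/funext => -[|j] //=; rewrite /upd eqSS; case: eqP => // ->.
Qed.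

Lemma exec_emit b io e : exec (Push 0 b) (regs io e) (regs (b :: io) e).
Proof.
suff <- : upd (regs io e) 0 (b :: io) = regs (b :: io) e by exact: exec_push.
by apply/funext => -[|j].
Qed.

Lemma exec_skim b io e : exec (Pop 0) (regs (b :: io) e) (regs io e).
Proof.
suff <- : upd (regs (b :: io) e) 0 io = regs io e by exact: exec_pop.
by apply/funext => -[|j].
Qed.

Lemma head_regs r io e : head false (regs io e r.+1) = (0 < e r).
Proof. by rewrite /=; case: (e r). Qed.

Lemma exec_while i c n (F : nat -> store) :
    (forall k, k < n -> head false (F k i) /\ exec c (F k) (F k.+1)) ->
    head false (F n i) = false ->
  exec (While i c) (F 0) (F n).
Proof.
elim: n F => [|n IHn] F HF Fn; first exact: exec_stop.
have [h0 e0] := HF 0 erefl; apply: exec_loop h0 e0 _.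
exact: (IHn (fun k => F k.+1)) (fun k kn => HF k.+1 kn) Fn.
Qed.

(* [io k] and [e k] are the contents when [k] iterations are left. *)
Lemma exec_for r c n (io : nat -> seq bool) (e : nat -> nat -> nat) :
    (forall k, e k r = k) ->
    (forall k, k < n -> exec c (regs (io k.+1) (upd (e k.+1) r k))
                              (regs (io k) (e k))) ->
  exec (While r.+1 (Seq (Pop r.+1) c)) (regs (io n) (e n)) (regs (io 0) (e 0)).
Proof.
move=> er ex.
have := @exec_while r.+1 (Seq (Pop r.+1) c) n
  (fun k => regs (io (n - k)) (e (n - k))).
rewrite subn0 subnn; apply; last by rewrite head_regs er.
move=> k kn; rewrite head_regs er subn_gt0 kn; split => //.
rewrite subnS; case E : (n - k) => [|p]; first by move: E; lia.
apply: exec_seq; first by apply: exec_dec; rewrite er.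
by apply: ex; move: E; lia.
Qed.

Definition clear r := While r.+1 (Pop r.+1).

Lemma exec_clear r io e : exec (clear r) (regs io e) (regs io (upd e r 0)).
Proof.
have := @exec_while r.+1 (Pop r.+1) (e r)
  (fun k => regs io (upd e r (e r - k))).
rewrite subn0 subnn (upd_id erefl); apply; last by rewrite head_regs upd_eq.
move=> k kn; rewrite head_regs upd_eq subn_gt0 kn; split => //.
have := @exec_dec r (e r - k.+1) io (upd e r (e r - k)).
by rewrite upd_upd; apply; rewrite upd_eq; lia.
Qed.

Definition move_reg a b := While a.+1 (Seq (Pop a.+1) (Push b.+1 true)).

Lemma exec_move a b io e : a != b ->
  exec (move_reg a b) (regs io e) (regs io (upd (upd e a 0) b (e b + e a))).
Proof.
move=> ab; have := @exec_for a (Push b.+1 true) (e a) (fun=> io)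
  (fun k => upd (upd e a k) b (e b + (e a - k))).
rewrite subnn subn0 addn0 (upd_id (erefl (e a))) (upd_id (erefl (e b))).
apply=> [k|k ka]; first by rewrite upd_neq // upd_eq.
set f := (X in exec _ (regs _ X) _).
suff -> : upd (upd e a k) b (e b + (e a - k)) = upd f b (f b).+1.
  exact: exec_inc.
rewrite /f; apply/funext => j; by upd_cases.
Qed.

(** Reading a register empties it, so a second copy is made in [k.+1], from which [a] is
    restored. *)
Definition copy_reg a k :=
  Seq (While a.+1 (Seq (Pop a.+1) (Seq (Push k.+1 true) (Push k.+2 true))))
      (move_reg k.+1 a).

Lemma exec_copy a k io e : a < k -> e k = 0 -> e k.+1 = 0 ->
  exec (copy_reg a k) (regs io e) (regs io (upd e k (e a))).
Proof.
move=> ak ek ek1; set f := fun n => upd (upd (upd e a n) k (e a - n)) k.+1 (e a - n).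
have f0 : f (e a) = e.
  by rewrite /f subnn (upd_id (erefl (e a))) (upd_id ek) (upd_id ek1).
apply: (@exec_seq _ _ _ (regs io (f 0))).
  rewrite -[in X in exec _ (regs _ X)]f0; apply: (@exec_for _ _ _ (fun=> io)).
    by move=> n; rewrite /f; upd_cases.
  move=> n na; apply: exec_seq; first exact: exec_inc.
  set g := (X in exec _ (regs _ X) _).
  suff -> : f n = upd g k.+1 (g k.+1).+1 by exact: exec_inc.
  by rewrite /g /f; apply/funext => j; upd_cases.
have := @exec_move k.+1 a io (f 0).
suff -> : upd (upd (f 0) k.+1 0) a (f 0 a + f 0 k.+1) = upd e k (e a) by apply; lia.
by rewrite /f; apply/funext => j; upd_cases.
Qed.

(* The registers from [k] on are scratch space, clean before and after except
   for the result in [k]: this is what makes such programs compose. *)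
Definition computable (f : (nat -> nat) -> nat) : Prop :=
  forall rho k, (forall i, rho i < k) -> exists c, forall io e,
    (forall i, k <= i -> e i = 0) ->
    exec c (regs io e) (regs io (upd e k (f (e \o rho)))).

(** Extension of an environment by a new variable 0, the variables being de Bruijn indices. *)
Definition scons n (s : nat -> nat) : nat -> nat :=
  fun i => if i is j.+1 then s j else n.

Lemma computable_var n : computable (fun s => s n).
Proof.
move=> rho k rhok; exists (copy_reg (rho n) k) => io e e0.
by apply: exec_copy; rewrite ?e0.
Qed.

Lemma computable_0 : computable (fun=> 0).
Proof.
(* Register [k] is already 0, so this loop serves as a skip command. *)
move=> rho k rhok; exists (While k.+1 (Pop 0)) => io e e0.
by rewrite upd_id ?e0 //; apply: exec_stop; rewrite head_regs e0.
Qed.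

Lemma computable_succ f : computable f -> computable (fun s => (f s).+1).
Proof.
move=> cf rho k rhok; have [c ec] := cf rho k rhok.
exists (Seq c (Push k.+1 true)) => io e e0; apply: exec_seq (ec _ _ e0) _.
set g := (X in exec _ (regs _ X) _).
suff -> : upd e k (f (e \o rho)).+1 = upd g k (g k).+1 by exact: exec_inc.
by rewrite /g upd_upd upd_eq.
Qed.

(** The quantification over [rho] in [computable] absorbs any renaming of variables. *)
Lemma computable_ren (xi : nat -> nat) f :
  computable f -> computable (fun s => f (s \o xi)).
Proof. by move=> cf rho k rhok; apply: (cf (rho \o xi)) => i /=. Qed.

Lemma comp_upd e rho k x : (forall i, rho i < k) -> upd e k x \o rho = e \o rho.
Proof.
by move=> rhok; apply/funext => i /=; rewrite upd_neq // neq_ltn rhok.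
Qed.

(** The value of [f] stays in register [k] while [g] works from [k.+1] on; its result is then moved
    down to [k]. *)
Lemma computable_let f g : computable f -> computable g ->
  computable (fun s => g (scons (f s) s)).
Proof.
move=> cf cg rho k rhok; have [c ec] := cf rho k rhok.
have [|d ed] := cg (scons k rho) k.+1; first by case=> [|i] //=; rewrite ltnS ltnW.
exists (Seq c (Seq d (Seq (clear k) (move_reg k.+1 k)))) => io e e0.
apply: exec_seq (ec _ _ e0) _; set e1 := upd e k _.
have e10 i : k < i -> e1 i = 0 by have := e0 i; rewrite /e1; upd_cases.
apply: exec_seq (ed _ _ e10) _; apply: exec_seq (exec_clear _ _ _) _.
have -> : e1 \o scons k rho = scons (f (e \o rho)) (e \o rho).
  apply/funext => -[|i] /=; rewrite /e1 ?upd_eq //.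
  by rewrite upd_neq // neq_ltn rhok.
set v := g _; set e2 := upd _ k 0.
suff -> : upd e k v = upd (upd e2 k.+1 0) k (e2 k + e2 k.+1).
  by apply: exec_move; lia.
have ek1 := e0 k.+1 (leqnSn _).
by apply/funext => j; rewrite /e2 /e1; upd_cases.
Qed.

(** Register [k] counts the remaining rounds, [k.+1] holds the accumulator and [k.+2] the number of
    rounds done; the body writes its result to [k.+3]. *)
Lemma computable_iteri n g b : computable n -> computable b -> computable g ->
  computable (fun s => iteri (n s) (fun i x => g (scons x (scons i s))) (b s)).
Proof.
move=> cn cb cg rho k rhok; have [c ec] := cn rho k rhok.
have rhok1 i : rho i < k.+1 by rewrite ltnS ltnW.
have [d ed] := cb rho k.+1 rhok1.
have [|a ea] := cg (scons k.+1 (scons k.+2 rho)) k.+3.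
  by case=> [|[|i]] //=; have := rhok i; lia.
exists (Seq c (Seq d (Seq (While k.+1 (Seq (Pop k.+1)
  (Seq a (Seq (clear k.+1) (Seq (move_reg k.+3 k.+1) (Push k.+3 true))))))
  (Seq (clear k.+2) (move_reg k.+1 k))))) => io e e0.
set s := e \o rho; set N := n s.
set F := fun m => upd (upd (upd e k m) k.+1
  (iteri (N - m) (fun i x => g (scons x (scons i s))) (b s))) k.+2 (N - m).
apply: exec_seq (ec _ _ e0) _.
have e10 i : k < i -> upd e k N i = 0.
  by have := e0 i; upd_cases.
apply: exec_seq (ed _ _ e10) _; rewrite comp_upd // -/s.
have FN : upd (upd e k N) k.+1 (b s) = F N.
  have ek1 := e0 k.+1; have ek2 := e0 k.+2.
  by rewrite /F subnn; apply/funext => j; upd_cases.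
rewrite FN; apply: (@exec_seq _ _ _ (regs io (F 0))).
  apply: (@exec_for _ _ _ (fun=> io)).
    by move=> m; rewrite /F; upd_cases.
  move=> m mN; set f0 := upd (F m.+1) k m.
  have f00 i : k.+2 < i -> f0 i = 0.
    by have := e0 i; rewrite /f0 /F; upd_cases.
  apply: exec_seq (ea _ _ f00) _.
  have -> : f0 \o scons k.+1 (scons k.+2 rho) =
      scons (iteri (N - m.+1) (fun i x => g (scons x (scons i s))) (b s))
            (scons (N - m.+1) s).
    apply/funext => -[|[|i]] /=; rewrite /f0 /F.
    - by upd_cases.
    - by upd_cases.
    - by have := rhok i; rewrite /s /=; upd_cases.
  set v := g _; apply: exec_seq (exec_clear _ _ _) _.
  apply: exec_seq; first by apply: exec_move; lia.
  set h := (X in exec _ (regs _ X) _).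
  suff -> : F m = upd h k.+2 (h k.+2).+1 by exact: exec_inc.
  have E : N - m = (N - m.+1).+1 by move: mN; lia.
  have ek3 := e0 k.+3; rewrite /h /f0 /F E /= -/v.
  by apply/funext => j; upd_cases.
apply: exec_seq (exec_clear _ _ _) _.
set h := (X in exec _ (regs _ X) _).
set v := iteri _ _ _.
suff -> : upd e k v = upd (upd h k.+1 0) k (h k + h k.+1).
  by apply: exec_move; lia.
have ek1 := e0 k.+1; have ek2 := e0 k.+2; rewrite /h /F subn0 -/v.
by apply/funext => j; upd_cases.
Qed.

End RegisterPrograms.

(** * Arithmetic operations are computable *)

Section ComputableFunctions.
Local Open Scope nat_scope.
Implicit Types (a b c f g : (nat -> nat) -> nat).

Lemma computable_comp1 (F : nat -> nat) a :
  computable (fun s => F (s 0)) -> computable a -> computable (fun s => F (a s)).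
Proof. by move=> cF ca; exact: (computable_let ca cF). Qed.

Lemma computable_comp2 (F : nat -> nat -> nat) a b :
  computable (fun s => F (s 0) (s 1)) -> computable a -> computable b ->
  computable (fun s => F (a s) (b s)).
Proof.
move=> cF ca cb.
(* After the two bindings [b] is variable 0 and [a] is variable 1, hence the swap. *)
have cF' := computable_ren (fun i => 1 - i) cF.
exact: (computable_let ca (computable_let (computable_ren succn cb) cF')).
Qed.

Lemma computable_const n : computable (fun=> n).
Proof.
by elim: n => [|n IHn]; [exact: computable_0|exact: computable_succ].
Qed.

Lemma computable_add a b : computable a -> computable b ->
  computable (fun s => a s + b s).
Proof.
apply: computable_comp2; rewrite (_ : (fun _ => _) = fun s =>
    iteri (s 0) (fun i x => (scons x (scons i s) 0).+1) (s 1)).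
  apply: (@computable_iteri _ (fun s => (s 0).+1));
    do ?[exact: computable_var|exact: computable_succ (computable_var _)].
by apply/funext => s /=; elim: (s 0) => //= n <-.
Qed.

Lemma computable_pred a : computable a -> computable (fun s => (a s).-1).
Proof.
apply: computable_comp1; rewrite (_ : (fun _ => _) = fun s =>
    iteri (s 0) (fun i x => scons x (scons i s) 1) 0).
  apply: (@computable_iteri _ (fun s => s 1));
    do ?[exact: computable_var|exact: computable_0].
by apply/funext => s /=; case: (s 0).
Qed.

Lemma computable_sub a b : computable a -> computable b ->
  computable (fun s => a s - b s).
Proof.
apply: computable_comp2; rewrite (_ : (fun _ => _) = fun s =>
    iteri (s 1) (fun i x => (scons x (scons i s) 0).-1) (s 0)).
  apply: (@computable_iteri _ (fun s => (s 0).-1));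
    do ?[exact: computable_var|exact: computable_pred (computable_var _)].
by apply/funext => s /=; elim: (s 1) => [|n IHn] /=; rewrite ?subn0 // -IHn subnS.
Qed.

Lemma computable_sum n (F : nat -> (nat -> nat) -> nat) : computable n ->
  computable (fun s => F (s 0) (fun i => s i.+1)) ->
  computable (fun s => \sum_(i < n s) F i s).
Proof.
move=> cn cF; rewrite (_ : (fun _ => _) = fun s =>
    iteri (n s) (fun i x => (fun s => s 0 + F (s 1) (fun i => s i.+2))
      (scons x (scons i s))) 0).
  apply: (@computable_iteri _ (fun s => s 0 + F (s 1) (fun i => s i.+2)));
    [exact: cn|exact: computable_0|].
  apply: computable_add; first exact: computable_var.
  exact: (computable_ren succn cF).
apply/funext => s; elim: (n s) => [|k IHk] /=; first by rewrite big_ord0.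
by rewrite big_ord_recr /= IHk addnC.
Qed.

Lemma computable_mul a b : computable a -> computable b ->
  computable (fun s => a s * b s).
Proof.
apply: computable_comp2; rewrite (_ : (fun _ => _) = fun s =>
    \sum_(i < s 0) (fun _ s => s 1) (i : nat) s).
  exact: (@computable_sum _ (fun _ s => s 1) (computable_var 0) (computable_var 2)).
by apply/funext => s; rewrite sum_nat_const card_ord.
Qed.

Lemma computable_exp a b : computable a -> computable b ->
  computable (fun s => a s ^ b s).
Proof.
apply: computable_comp2; rewrite (_ : (fun _ => _) = fun s =>
    iteri (s 1) (fun i x => (fun s => s 2 * s 0) (scons x (scons i s))) 1).
  apply: (@computable_iteri _ (fun s => s 2 * s 0));
    [exact: computable_var|exact: computable_const|].
  by apply: computable_mul; exact: computable_var.
by apply/funext => s; elim: (s 1) => //= n <-; rewrite expnS.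
Qed.

(** The quotient counts the [i < a] with [(i + 1) * b <= a], a condition expressed by truncated
    subtraction. The first factor makes the sum 0 for [b = 0], in accordance with [divn0]. *)
Lemma computable_div a b : computable a -> computable b ->
  computable (fun s => a s %/ b s).
Proof.
apply: computable_comp2; rewrite (_ : (fun _ => _) = fun s =>
    \sum_(i < s 0) (fun i s => (1 - (1 - s 1)) * (1 - (i.+1 * s 1 - s 0))) i s).
  apply: (@computable_sum _
      (fun i s => (1 - (1 - s 1)) * (1 - (i.+1 * s 1 - s 0)))).
    exact: computable_var.
  by do ?[apply: computable_mul|apply: computable_sub|apply: computable_succ
         |exact: computable_var|exact: computable_const].
apply/funext => s; case: (posnP (s 1)) => [->|s1].
  by rewrite divn0 big1.
rewrite (eq_bigr (fun i : 'I_(s 0) => nat_of_bool (i < s 0 %/ s 1))); last first.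
  by move=> i _; rewrite leq_divRL //; lia.
have := leq_div (s 0) (s 1); move: (s 0 %/ s 1) => q qs.
rewrite -(subnKC qs) big_split_ord /= (eq_bigr (fun=> 1)); last first.
  by move=> i _; rewrite ltn_ord.
rewrite sum_nat_const card_ord muln1 big1 ?addn0 // => i _.
by rewrite ltnNge leq_addr.
Qed.

Lemma computable_mod a b : computable a -> computable b ->
  computable (fun s => a s %% b s).
Proof.
move=> ca cb; rewrite (_ : (fun _ => _) = fun s => a s - a s %/ b s * b s).
  by apply: computable_sub => //; apply: computable_mul => //; exact: computable_div.
by apply/funext => s; rewrite {2}(divn_eq (a s) (b s)) addKn.
Qed.

Lemma computable_min a b : computable a -> computable b ->
  computable (fun s => minn (a s) (b s)).
Proof.
move=> ca cb; rewrite (_ : (fun _ => _) = fun s => a s - (a s - b s)).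
  by do 2![apply: computable_sub => //].
by apply/funext => s; lia.
Qed.

End ComputableFunctions.

(** * Reading a marked word and printing a list of points *)

Section OutputMachine.
Local Open Scope nat_scope.

Definition pair_store (N L : nat) : nat -> nat := scons N (scons L (fun=> 0)).

Definition binary_value (w : seq bool) : nat :=
  foldl (fun n (b : bool) => n.*2 + b) 0 w.

(* Marking every bit with a preceding [true] makes the end of the word
   detectable by a loop that tests for [true]. *)
Definition marked (w : seq bool) : seq bool :=
  flatten [seq [:: true; b] | b <- w].

Lemma size_marked w : size (marked w) = (size w).*2.
Proof. by rewrite /marked; elim: w => //= b w ->; rewrite doubleS. Qed.

Definition double_cmd :=
  Seq (While 1 (Seq (Pop 1) (Seq (Push 3 true) (Push 3 true)))) (move_reg 2 0).

Lemma exec_double io N L :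
  exec double_cmd (regs io (pair_store N L)) (regs io (pair_store N.*2 L)).
Proof.
set e := pair_store N L; set F := fun k => upd (upd e 0 k) 2 (N - k).*2.
apply: (@exec_seq _ _ _ (regs io (F 0))).
  have -> : e = F N.
    by apply/funext => -[|[|[|j]]]; rewrite /e /F /=; upd_cases.
  apply: (@exec_for 0 _ _ (fun=> io)) => // k kN.
  apply: exec_seq; first exact: (exec_inc 2).
  set g := (X in exec _ (regs _ X) _).
  suff -> : F k = upd g 2 (g 2).+1 by exact: exec_inc.
  by rewrite /g /F; apply/funext => j; upd_cases.
have := @exec_move 2 0 io (F 0) isT.
suff -> : upd (upd (F 0) 2 0) 0 (F 0 0 + F 0 2) = pair_store N.*2 L by [].
by apply/funext => -[|[|[|j]]]; rewrite /F /e /=; upd_cases.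
Qed.

(** Each round drops a mark, doubles register 0, adds the next bit to it and counts that bit in
    register 1. The inner loop is a conditional: it replaces a bit [true] by [false], so it runs at
    most once. *)
Definition read_cmd := While 0 (Seq (Pop 0) (Seq double_cmd
  (Seq (While 0 (Seq (Pop 0) (Seq (Push 1 true) (Push 0 false))))
    (Seq (Pop 0) (Push 2 true))))).

Lemma exec_read w N L :
  exec read_cmd (regs (marked w) (pair_store N L))
    (regs [::] (pair_store (foldl (fun n (b : bool) => n.*2 + b) N w)
                           (L + size w))).
Proof.
elim: w N L => [|b w IHw] N L; first by rewrite addn0; exact: exec_stop.
apply: exec_loop => //; last by rewrite /= -addSnnS; exact: IHw.
apply: exec_seq; first exact: exec_skim.
apply: exec_seq; first exact: exec_double.
apply: (@exec_seq _ _ _ (regs (false :: marked w) (pair_store (N.*2 + b) L))).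
  case: b; last by rewrite addn0; exact: exec_stop.
  apply: exec_loop => //; last exact: exec_stop.
  apply: exec_seq; first exact: exec_skim.
  apply: exec_seq; first exact: (exec_inc 0).
  rewrite (_ : upd _ _ _ = pair_store (N.*2 + true) L); first exact: exec_emit.
  by apply/funext => -[|[|j]] //=; rewrite /upd /= addn1.
apply: exec_seq; first exact: exec_skim.
rewrite (_ : pair_store _ L.+1 = upd (pair_store (N.*2 + b) L) 1 L.+1).
  exact: (exec_inc 1).
by apply/funext => -[|[|j]].
Qed.

Definition unary_cmd r := While r.+1 (Seq (Pop r.+1) (Push 0 true)).

Lemma exec_unary r io e :
  exec (unary_cmd r) (regs io e) (regs (nseq (e r) true ++ io) (upd e r 0)).
Proof.
have := @exec_for r (Push 0 true) (e r) (fun k => nseq (e r - k) true ++ io)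
  (fun k => upd e r k).
rewrite subnn subn0 (upd_id (erefl (e r))); apply=> [k|k ke].
  exact: upd_eq.
rewrite upd_upd (_ : nseq (e r - k) true = true :: nseq (e r - k.+1) true).
  exact: exec_emit.
by rewrite -(subnSK ke).
Qed.

Variables (T D : nat -> nat -> nat) (V : nat -> nat -> nat -> nat).
Hypothesis compT : computable (fun s => T (s 0) (s 1)).
Hypothesis compD : computable (fun s => D (s 0) (s 1)).
Hypothesis compV : computable (fun s => V (s 0) (s 1) (s 2)).

Lemma list_machine : exists M : turing_machine, forall w,
  computes M (marked w) (list_word [seq (false, V (binary_value w) (size w) j,
                                         D (binary_value w) (size w))
                      | j <- iota 0 (T (binary_value w) (size w))]).
Proof.
(* [minn 1] keeps variables 0 and 1 and sends the others to 1, as all variables must lie below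
   register [k]. *)
have [|cT eT] := compT (rho := minn 1) (k := 2).
  by move=> i; lia.
have [|cD eD] := compD (rho := minn 2) (k := 3).
  by move=> i; lia.
have [|cV eV] := compV (rho := minn 2) (k := 3).
  by move=> i; lia.
set point := Seq cD (Seq (Push 0 false) (Seq (unary_cmd 3) (Seq (Push 0 false)
  (Seq cV (Seq (unary_cmd 3) (Push 0 false)))))).
have [M computesM] := exec_computes
  (Seq read_cmd (Seq cT (While 3 (Seq (Pop 3) point)))).
exists M => w; set N := binary_value w; set L := size w.
set P := fun j => (false, V N L j, D N L).
set e := fun k => upd (pair_store N L) 2 k.
suff : exec (Seq read_cmd (Seq cT (While 3 (Seq (Pop 3) point))))
    (upd (fun=> [::]) 0 (marked w))
    (regs (list_word [seq P j | j <- iota 0 (T N L)]) (e 0)).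
  exact: computesM.
apply: exec_seq.
  rewrite (_ : upd _ _ _ = regs (marked w) (pair_store 0 0)); first exact: exec_read.
  by apply/funext => -[|[|[|j]]].
rewrite add0n -/(binary_value w) -/N -/L.
apply: exec_seq; first by apply: eT => -[|[|i]].
rewrite (_ : T _ _ = T N L) // -/(e _).
have := @exec_for 2 point (T N L)
  (fun k => list_word [seq P j | j <- iota k (T N L - k)]) e.
rewrite subnn subn0; apply=> [k|k kT]; first exact: upd_eq.
rewrite /e upd_upd -/(e k) -(subnSK kT) /=.
have e0 i : 3 <= i -> e k i = 0 by case: i => [|[|[|i]]].
set l := map P _; rewrite {2}/list_word [map _ (_ :: _)]/= [flatten (_ :: _)]/=.
rewrite -/(list_word l) /point.
apply: exec_seq; first exact: eD e0.
rewrite (_ : D _ _ = D N L) //.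
apply: exec_seq; first exact: exec_emit.
apply: exec_seq; first exact: exec_unary.
rewrite upd_eq upd_upd.
have -> : upd (e k) 3 0 = e k by rewrite upd_id // e0.
apply: exec_seq; first exact: exec_emit.
apply: exec_seq; first exact: eV e0.
rewrite (_ : V _ _ _ = V N L k) //.
apply: exec_seq; first exact: exec_unary.
rewrite upd_eq upd_upd.
have -> : upd (e k) 3 0 = e k by rewrite upd_id // e0.
have := exec_emit false
  (nseq (V N L k) true ++ false :: nseq (D N L) true ++ false :: list_word l) (e k).
by rewrite /point_word /P -!catA /= -!catA.
Qed.

End OutputMachine.

(** * Orbits in fixed-point arithmetic *)

Section IntegerOrbits.
Local Open Scope nat_scope.

Definition digit (N b f : nat) : nat := N %/ b ^ f %% b.

(* Integer version of the polynomial whose [j]-th coefficient is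
   [digit N (2 ^ h) (f * d + j) / 2 ^ m], at the point [x / 2 ^ m], scaled by
   [2 ^ (m * d + m)]. *)
Definition int_horner (d N h m f x : nat) : nat :=
  \sum_(j < d) digit N (2 ^ h) (f * d + j) * (x ^ j * (2 ^ m) ^ (d - j)).

(** Signed coefficients are split into positive and negative parts, stored as polynomials [2 i] and
    [2 i + 1]. Truncated subtraction and the minimum clip the value to the codes of points of
    [0, 1]. *)
Definition int_map (d N h m i x : nat) : nat :=
  minn (2 ^ m) ((int_horner d N h m (i * 2) x
                 - int_horner d N h m (i * 2 + 1) x) %/ (2 ^ m) ^ d).

(** The base-[q] digits of [w], lowest first, are the itinerary. *)
Definition int_orbit (d q N h m k w : nat) : nat :=
  iteri k (fun t x => int_map d N h m (digit w q t) x) 0.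

Implicit Types a : (nat -> nat) -> nat.

Lemma computable_digit a1 a2 a3 : computable a1 -> computable a2 ->
  computable a3 -> computable (fun s => digit (a1 s) (a2 s) (a3 s)).
Proof.
move=> c1 c2 c3; apply: computable_mod => //; apply: computable_div => //.
exact: computable_exp.
Qed.

Lemma computable_int_horner d a1 a2 a3 a4 a5 : computable a1 -> computable a2 ->
    computable a3 -> computable a4 -> computable a5 ->
  computable (fun s => int_horner d (a1 s) (a2 s) (a3 s) (a4 s) (a5 s)).
Proof.
move=> c1 c2 c3 c4 c5.
apply: (@computable_sum (fun=> d) (fun j s =>
  digit (a1 s) (2 ^ a2 s) (a4 s * d + j) * (a5 s ^ j * (2 ^ a3 s) ^ (d - j)))).
  exact: computable_const.
do ?[apply: computable_mul|apply: computable_digit|apply: computable_exp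
    |apply: computable_add|apply: computable_sub|exact: computable_var
    |exact: computable_const|exact: (computable_ren succn c1)
    |exact: (computable_ren succn c2)|exact: (computable_ren succn c3)
    |exact: (computable_ren succn c4)|exact: (computable_ren succn c5)].
Qed.

Lemma computable_int_map d a1 a2 a3 a4 a5 : computable a1 -> computable a2 ->
    computable a3 -> computable a4 -> computable a5 ->
  computable (fun s => int_map d (a1 s) (a2 s) (a3 s) (a4 s) (a5 s)).
Proof.
move=> c1 c2 c3 c4 c5.
by do ?[apply: computable_min|apply: computable_div|apply: computable_exp
    |apply: computable_sub|apply: computable_int_horner|apply: computable_mul
    |apply: computable_add|exact: computable_const] => //.
Qed.

Lemma computable_int_orbit d q a1 a2 a3 a4 a5 : computable a1 ->
    computable a2 -> computable a3 -> computable a4 -> computable a5 ->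
  computable (fun s => int_orbit d q (a1 s) (a2 s) (a3 s) (a4 s) (a5 s)).
Proof.
move=> c1 c2 c3 c4 c5.
(* The iteration binds two variables, the current point [s 0] and the time [s 1]; [sh] lifts the
   parameters over them. *)
pose sh a : (nat -> nat) -> nat := fun s => a (fun i => s i.+2).
have csh a : computable a -> computable (sh a).
  exact: (computable_ren (fun i => i.+2)).
apply: (@computable_iteri _ (fun s =>
  int_map d (sh a1 s) (sh a2 s) (sh a3 s) (digit (sh a5 s) q (s 1)) (s 0))) => //.
  exact: computable_const.
apply: computable_int_map; do ?[exact: csh|exact: computable_var].
by apply: computable_digit;
  [exact: csh|exact: computable_const|exact: computable_var].
Qed.

Lemma digits_ex b n (v : nat -> nat) : (forall t, t < n -> v t < b) ->
  exists2 N, N < b ^ n & forall t, t < n -> digit N b t = v t.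
Proof.
elim: n => [|n IHn] vb; first by exists 0.
have [t /ltnW|N Nn Nv] := IHn; first exact: vb.
exists (v n * b ^ n + N) => [|t].
  rewrite expnS (leq_trans (_ : _ < (v n).+1 * b ^ n)) //.
    by rewrite mulSn addnC ltn_add2r.
  by rewrite leq_mul2r vb ?orbT.
have b0 : 0 < b by rewrite (leq_ltn_trans _ (vb n _)).
rewrite ltnS leq_eqVlt => /predU1P[->|tn]; rewrite /digit.
  by rewrite divnMDl ?expn_gt0 ?b0 // divn_small // addn0 modn_small // vb.
have -> : v n * b ^ n = v n * b ^ (n - t.+1) * b * b ^ t.
  by rewrite -mulnA -expnS -mulnA -expnD subnK.
by rewrite divnMDl ?expn_gt0 ?b0 // modnMDl; exact: Nv.
Qed.

Lemma binary_value_ex n N : N < 2 ^ n ->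
  exists2 w, size w = n & binary_value w = N.
Proof.
elim: n N => [|n IHn] N Nn.
  by exists [::] => //; case: N Nn.
have [|w sw vw] := IHn N./2; first by move: Nn; rewrite expnS; lia.
exists (rcons w (odd N)); first by rewrite size_rcons sw.
rewrite /binary_value foldl_rcons -/(binary_value w) vw addnC.
exact: odd_double_half.
Qed.

(** One word transmits two numbers: its value is [N], and its length divided by [q * 2 * d] is [h],
    whence the precision [m]. The denominator is stored as [(2 ^ m).-1] because [point_value] adds
    1. *)
Lemma orbit_machine (d q c l : nat) : exists M : turing_machine, forall h N,
    let m := h - c in N < 2 ^ (q * 2 * d * h) -> 0 < q * 2 * d ->
  exists2 w, size w = (q * 2 * d * h).*2 &
    computes M w (list_word
      [seq (false, int_orbit d q N h m (m * l) j, (2 ^ m).-1)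
      | j <- iota 0 (q ^ (m * l))]).
Proof.
set F := q * 2 * d; pose m L := L %/ F - c.
have compm : computable (fun s => m (s 1)).
  apply: computable_sub; last exact: computable_const.
  by apply: computable_div; [exact: computable_var|exact: computable_const].
have compk : computable (fun s => m (s 1) * l).
  by apply: computable_mul => //; exact: computable_const.
have [|||M compM] := @list_machine (fun _ L => q ^ (m L * l))
    (fun _ L => (2 ^ m L).-1)
    (fun N L j => int_orbit d q N (L %/ F) (m L) (m L * l) j).
- by apply: computable_exp => //; exact: computable_const.
- by apply: computable_pred; apply: computable_exp => //; exact: computable_const.
- apply: computable_int_orbit => //; try exact: computable_var.
  by apply: computable_div; [exact: computable_var|exact: computable_const].
exists M => h N /= Nh F0; have [w sw vw] := binary_value_ex Nh.
exists (marked w); first by rewrite size_marked sw.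
by have := compM w; rewrite vw sw /m mulKn.
Qed.

End IntegerOrbits.

(** * Error estimates for maps and orbits *)

Section PolynomialSystems.
Variable R : realType.
Implicit Types (x y : R) (a : nat -> R).

Lemma int_horner_natr d N h m f n : (int_horner d N h m f n)%:R =
  2 ^+ m ^+ d * \sum_(j < d) (digit N (2 ^ h) (f * d + j))%:R
    * (n%:R / 2 ^+ m) ^+ j :> R.
Proof.
rewrite /int_horner natr_sum mulr_sumr; apply: eq_bigr => j _.
rewrite !natrM !natrX exprMn exprVn [RHS]mulrCA; congr (_ * _).
rewrite [RHS]mulrCA; congr (_ * _).
have B0 : (2 ^+ m ^+ j : R) != 0 by rewrite !expf_neq0 // pnatr_eq0.
by apply: (canRL (mulfK B0)); rewrite -exprD subnK // ltnW.
Qed.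

(** In units of 2^-m, each of the [d] coefficients contributes an error of at most 1, powers of a
    point of [0, 1] being at most 1, and the integer division one more. Clipping does no harm, as
    the true value lies in [0, 1]. *)
Lemma int_map_approx d N h m i n a :
    (forall j, (j < d)%N -> `|(digit N (2 ^ h) (i * 2 * d + j))%:R
       - (digit N (2 ^ h) ((i * 2 + 1) * d + j))%:R - 2 ^+ m * a j| <= 1) ->
    (n <= 2 ^ m)%N ->
    0 <= \sum_(j < d) a j * (n%:R / 2 ^+ m) ^+ j <= 1 ->
  `|(int_map d N h m i n)%:R / 2 ^+ m
    - \sum_(j < d) a j * (n%:R / 2 ^+ m) ^+ j| <= d.+1%:R / 2 ^+ m.
Proof.
set y := n%:R / _; set p := \sum_(j < d) a j * _ => approx nm /andP[p0 p1].
have B0 : 0 < 2 ^+ m :> R by rewrite exprn_gt0.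
have Bd0 : 0 < 2 ^+ m ^+ d :> R by rewrite exprn_gt0.
have y0 : 0 <= y by rewrite divr_ge0 // ltW.
have y1 : y <= 1 by rewrite ler_pdivrMr // mul1r -natrX ler_nat.
set P := int_horner d N h m (i * 2) n.
set Q := int_horner d N h m (i * 2 + 1) n.
set z := ((P - Q) %/ (2 ^ m) ^ d)%N.
pose u : R := \sum_(j < d) ((digit N (2 ^ h) (i * 2 * d + j))%:R
       - (digit N (2 ^ h) ((i * 2 + 1) * d + j))%:R) * y ^+ j.
have PQ : P%:R - Q%:R = 2 ^+ m ^+ d * u.
  rewrite !int_horner_natr -/y -mulrBr -sumrB; congr (_ * _).
  by apply: eq_bigr => j _; rewrite mulrBl.
have up : `|u - 2 ^+ m * p| <= d%:R.
  rewrite mulr_sumr -sumrB (le_trans (ler_norm_sum _ _ _)) //.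
  rewrite -[d in leRHS]card_ord -sumr_const ler_sum // => j _.
  rewrite mulrA -mulrBl normrM (ger0_norm (exprn_ge0 _ y0)).
  by rewrite mulr_ile1 ?exprn_ge0 ?exprn_ile1 ?approx.
have zu : u < z%:R + 1.
  rewrite -(ltr_pM2l Bd0) -PQ natr1 (le_lt_trans (_ : _ <= (P - Q)%N%:R)) //.
    by rewrite lerBlDr -natrD ler_nat; lia.
  by rewrite -!natrX -natrM ltr_nat mulnC ltn_ceil // !expn_gt0.
(* If the true difference is negative, truncated subtraction yields 0. *)
have uz : z%:R <= Num.max u 0.
  rewrite le_max; case: (leqP Q P) => QP; last first.
    by rewrite /z (_ : P - Q = 0)%N ?div0n ?lexx ?orbT //; lia.
  rewrite -(ler_pM2l Bd0) -PQ -natrB // -!natrX -natrM ler_nat mulnC.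
  by rewrite leq_divM.
have zp : `|z%:R - 2 ^+ m * p| <= d.+1%:R.
  have Bp0 : 0 <= 2 ^+ m * p by rewrite mulr_ge0 // ltW.
  move: up; rewrite !ler_norml -natr1 => /andP[up1 up2]; apply/andP; split.
    by move: zu up1; lra.
  move: uz; rewrite le_max => /orP[]; last lra.
  by move: up2; lra.
rewrite -(ler_pM2r B0) mulfVK ?gt_eqF // -[X in _ * X <= _](gtr0_norm B0) -normrM.
rewrite mulrBl mulfVK ?gt_eqF // [p * _]mulrC /int_map -/P -/Q -/z.
have p1' : 2 ^+ m * p <= 2 ^+ m by rewrite ler_piMr // ltW.
move: zp; rewrite !ler_norml => /andP[zp1 zp2]; rewrite /minn.
case: ltnP => [zm|zm]; last by apply/andP.
move: zm; rewrite -(ltr_nat R) natrX => zm.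
have d0 : 0 <= d%:R :> R by [].
move: zp1 zp2; rewrite -natr1 => zp1 zp2.
by apply/andP; split; lra.
Qed.

Variables (I : finType) (phi : I -> R -> R).

Definition trajectory (w : nat -> I) (k : nat) (x : R) : R :=
  iteri k (fun t y => phi (w t) y) x.

Lemma eq_trajectory w w' k x : (forall t, (t < k)%N -> w t = w' t) ->
  trajectory w k x = trajectory w' k x.
Proof.
by elim: k => //= k IHk ww'; rewrite ww' // IHk // => t tk; rewrite ww' // ltnW.
Qed.

Lemma generated_trajectory C w k x : generated_by phi C -> C x ->
  C (trajectory w k x).
Proof.
move=> [_ _ _ CE] Cx; elim: k => //= k IHk.
by rewrite CE; exists (w k) => //; exists (trajectory w k x).
Qed.

Lemma generated_trajectory_ex C k x : generated_by phi C -> C x ->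
  exists w y, C y /\ trajectory w k y = x.
Proof.
move=> gC; have [_ _ _ CE] := gC; elim: k x => [|k IHk] x Cx.
  by have := Cx; rewrite {1}CE => -[i _ _]; exists (fun=> i), x.
have := Cx; rewrite {1}CE => -[i _ [x' Cx' <-]].
have [w [y [Cy <-]]] := IHk _ Cx'.
exists (fun t => if t == k then i else w t), y; split => //=.
rewrite eqxx (@eq_trajectory _ w) // => t tk.
by rewrite ltn_eqF.
Qed.

(** The initial error is at most 1, and one step turns an error E into at most [e + rho * E]; the
    constant [e / (1 - rho)] is the fixed point of this recursion. *)
Lemma trajectory_approx rho (e : R) w (X : nat -> R) k x :
    0 < rho < 1 -> 0 <= e ->
    (forall i, set_fun `[0, 1] `[0, 1] (phi i)) ->
    (forall i x y, x \in `[0, 1] -> y \in `[0, 1] ->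
       `|phi i x - phi i y| <= rho * `|x - y|) ->
    (forall t, X t \in `[0, 1]) ->
    (forall t, (t < k)%N -> `|X t.+1 - phi (w t) (X t)| <= e) ->
    x \in `[0, 1] ->
  `|X k - trajectory w k x| <= rho ^+ k + e / (1 - rho).
Proof.
move=> /andP[rho0 rho1] e0 fphi lphi X01 Xe x01.
have q0 : 0 < 1 - rho by rewrite subr_gt0.
have tr01 t : trajectory w t x \in `[0, 1].
  elim: t => //= t IHt; have := fphi (w t) (trajectory w t x).
  by rewrite /= => /(_ IHt).
elim: k Xe => [|k IHk] Xe.
  rewrite expr0 /=; apply: (@le_trans _ _ 1); last by rewrite lerDl divr_ge0 // ltW.
  have := X01 0%N; move: x01; rewrite !in_itv /= => /andP[? ?] /andP[? ?].
  by rewrite ler_norml; apply/andP; split; lra.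
rewrite (le_trans (ler_distD (phi (w k) (X k)) _ _)) //=.
have := IHk (fun t tk => Xe t (ltnW tk)).
have /= := lphi (w k) _ _ (X01 k) (tr01 k).
have eG : e / (1 - rho) = e + rho * (e / (1 - rho)) by field; rewrite gt_eqF.
have := Xe k (ltnSn k); rewrite exprS.
set A := `|_|; set B := `|_|; set D := `|X k - _|; set G := e / _ in eG * => Ae BD DG.
by have := ler_wpM2l (ltW rho0) DG; rewrite mulrDr; lra.
Qed.

Lemma hausdorff_dist_le (F1 F2 : set R) (e : R) :
    (forall x, F2 x -> exists2 y, F1 y & `|x - y| <= e) ->
    (forall x, F1 x -> exists2 y, F2 y & `|x - y| <= e) ->
  (hausdorff_dist F1 F2 <= e%:E)%E.
Proof.
move=> h1 h2; rewrite /hausdorff_dist ge_max; apply/andP; split.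
- apply: ge_ereal_sup => _ [x Fx <-]; have [y Fy xy] := h1 _ Fx.
  apply: (@le_trans _ _ (edist (x, y))); last by rewrite edist_normE lee_fin.
  by apply: ereal_inf_lbound; exists y.
- apply: ge_ereal_sup => _ [x Fx <-]; have [y Fy xy] := h2 _ Fx.
  apply: (@le_trans _ _ (edist (x, y))); last by rewrite edist_normE lee_fin.
  by apply: ereal_inf_lbound; exists y.
Qed.

Lemma hausdorff_dist_lt (F1 F2 : set R) (e : R) :
    (hausdorff_dist F1 F2 < e%:E)%E ->
  (forall x, F2 x -> exists2 y, F1 y & `|x - y| < e) /\
  (forall x, F1 x -> exists2 y, F2 y & `|x - y| < e).
Proof.
rewrite /hausdorff_dist gt_max => /andP[h1 h2].
have near (A B : set R) : (ereal_sup [set edist_inf A x | x in B] < e%:E)%E ->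
    forall x, B x -> exists2 y, A y & `|x - y| < e.
  move=> h x Bx.
  have : (edist_inf A x < e%:E)%E.
    by apply: le_lt_trans h; apply: ereal_sup_ubound; exists x.
  by move=> /ereal_inf_lt[_ [y Ay <-]]; rewrite edist_normE lte_fin; exists y.
by split; apply: near.
Qed.

Lemma log2_exp n : log2 (2 ^+ n) = n%:R :> R.
Proof.
by rewrite /log2 lnXn // -[ln 2 *+ n]mulr_natl mulfK // gt_eqF // ln_gt0 ?ltr1n.
Qed.

Lemma ler_log2 : {in Num.pos &, {mono @log2 R : x y / x <= y}}.
Proof.
move=> x y x0 y0; rewrite /log2 ler_pM2r ?ler_ln //.
by rewrite invr_gt0 ln_gt0 ?ltr1n.
Qed.

End PolynomialSystems.

(** * The upper bound *)

Section UpperBound.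
Variable R : realType.

Lemma ltn_exp2_natr n : n%:R < 2 ^+ n :> R.
Proof. by rewrite -natrX ltr_nat ltn_expl. Qed.

(** With such an [l], a composition of [m * l] maps contracts by 2^-m. *)
Lemma pow_lt_half_ex (rho : R) : 0 < rho < 1 -> exists l, rho ^+ l <= 1 / 2.
Proof.
move=> /andP[rho0 rho1].
have /cvgrPdist_lt/(_ (1 / 2)) : (fun n => rho ^+ n) @ \oo --> (0 : R).
  by apply: cvg_expr; rewrite gtr0_norm.
move=> /(_ ltac:(lra)) [l _ /(_ l (leqnn l)) /=].
by rewrite sub0r normrN gtr0_norm ?exprn_gt0 // => /ltW; exists l.
Qed.

Variables (I : finType) (phi : I -> R -> R) (C : set R).

(* Digit number [(2 i + s) d + j] holds the coefficient of degree [j] of the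
   [i]-th map, [s] telling its positive from its negative part. *)
Lemma coefficient_digits (p : I -> {poly R}) (d : nat) (i0 : I) : (0 < d)%N ->
  exists c, forall m, exists2 N, (N < 2 ^ (#|I| * 2 * d * (m + c)))%N &
    forall i j, (i < #|I|)%N -> (j < d)%N ->
     `|(digit N (2 ^ (m + c)) (i * 2 * d + j))%:R
       - (digit N (2 ^ (m + c)) ((i * 2 + 1) * d + j))%:R
       - 2 ^+ m * (p (nth i0 (enum I) i))`_j| <= 1 :> R.
Proof.
move=> d0; pose a i j := (p (nth i0 (enum I) i))`_j.
pose A := \sum_(i < #|I|) \sum_(j < d) `|a i j|.
(* Every coefficient is at most [A < 2 ^+ c] in absolute value, so [m + c] bits suffice for it after
   scaling by 2^m. *)
pose c := (Num.truncn A).+1; exists c => m.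
have A0 : 0 <= A by do 2![apply: sumr_ge0 => ? _].
have Ac : A < 2 ^+ c by rewrite (lt_trans _ (ltn_exp2_natr _)) // truncnS_gt.
(* For [f = (2 i + s) d + j], the quotient by [d] has parity [s] and half [i], and the remainder is
   [j]. *)
pose v f := Num.truncn (2 ^+ m *
  Num.max 0 ((-1) ^+ odd (f %/ d) * a (f %/ d)./2 (f %% d)%N)).
have a_le i j : (i < #|I|)%N -> (j < d)%N -> `|a i j| <= A.
  move=> iI jd; rewrite /A (bigD1 (Ordinal iI)) //= (bigD1 (Ordinal jd)) //=.
  rewrite -addrA lerDl addr_ge0 ?sumr_ge0 // => k _.
  exact: sumr_ge0.
have trunc (y : R) : 0 <= y -> (Num.truncn y)%:R <= y < (Num.truncn y)%:R + 1.
  by move=> y0; rewrite truncn_le y0 natr1 truncnS_gt.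
have B0 : 0 <= 2 ^+ m :> R by rewrite exprn_ge0.
have [|N Nlt Nv] := @digits_ex (2 ^ (m + c)) (#|I| * 2 * d) v.
  move=> f fF; rewrite -(ltr_nat R) natrX exprD.
  have /trunc/andP[vf _] : 0 <= 2 ^+ m *
      Num.max 0 ((-1) ^+ odd (f %/ d) * a (f %/ d)./2 (f %% d)%N).
    by rewrite mulr_ge0 // le_max lexx.
  apply: le_lt_trans vf _.
  rewrite ltr_pM2l ?exprn_gt0 // (le_lt_trans _ Ac) // ge_max A0 /=.
  rewrite (le_trans (ler_norm _)) // normrM normrX normrN1 expr1n mul1r a_le //.
    by move: fF; rewrite -ltn_divLR //; lia.
  by rewrite ltn_mod.
exists N => [|i j iI jd]; first by rewrite [X in (_ < 2 ^ X)%N]mulnC expnM.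
rewrite !Nv; last 2 first.
- have : ((i * 2 + 1) * d + j < (i * 2 + 2) * d)%N by rewrite !mulnDl; lia.
  by move=> /leq_trans; apply; rewrite leq_mul2r; lia.
- have : (i * 2 * d + j < (i * 2 + 1) * d)%N by rewrite mulnDl; lia.
  by move=> /leq_trans; apply; rewrite leq_mul2r; lia.
rewrite /v !divnMDl // !modnMDl divn_small // modn_small // !addn0 !addn1 /=.
rewrite !muln2 odd_double uphalf_double doubleK /= expr0 expr1 mul1r mulN1r.
rewrite -/(a i j); set x := a i j.
(* One of the two parts vanishes, so only one truncation error remains. *)
have [x0|x0] := leP 0 x.
- rewrite (max_l (_ : - x <= 0)) ?oppr_le0 // mulr0 truncn0 subr0.
  have /andP[] := trunc _ (mulr_ge0 B0 x0) => ? ?.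
  by rewrite ler_norml; apply/andP; split; lra.
- rewrite mulr0 truncn0 sub0r (max_r (_ : 0 <= - x)); last by lra.
  have x0' : 0 <= - x by lra.
  have /andP[] := trunc _ (mulr_ge0 B0 x0'); rewrite mulrN => ? ?.
  by rewrite ler_norml; apply/andP; split; lra.
Qed.

Lemma complexity_upper_bound (U : turing_machine) : universal U ->
    is_ifs phi -> polynomial_system phi -> generated_by phi C ->
  exists2 K : R, 0 < K &
    \forall eps \near 0^'+,
      (distortion_complexity U C eps <= (K * log2 eps^-1)%:E)%E.
Proof.
move=> hU [I1 phi01 _ [rho rho01 phi_rho] _] /boolp.choice[p pE] genC.
have [Cn0 _ C01 _] := genC.
have i0 : I by move: I1 => /ltnW /card_gt0P /cid[].
pose d := (\max_i size (p i)).+1.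
pose q := #|I|; pose w_ w := fun t => nth i0 (enum I) (digit w q t).
have [c digits] := @coefficient_digits p d i0 isT.
have [l rhol] := pow_lt_half_ex rho01.
have [M compM] := orbit_machine d q c l.
have [pre preU] := hU M.
have rho1 : 0 < 1 - rho by move: rho01; lra.
(* In units of 2^-m: 1 bounds the effect of the starting point, the other term the accumulated
   rounding errors. *)
pose G : R := 1 + d.+1%:R / (1 - rho).
have q0 : (0 < q)%N by exact: ltnW.
have G0 : 0 <= G by rewrite addr_ge0 ?divr_ge0 // ltW.
pose F := (q * 2 * d)%N.
have F0 : (0 < F)%N by rewrite !muln_gt0 q0.
have phiE i x : x \in `[0, 1] -> phi i x = \sum_(j < d) (p i)`_j * x ^+ j.
  move=> x01; rewrite pE //; apply: horner_coef_wide.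
  by rewrite ltnW // ltnS leq_bigmax.
have approx m : exists P, size P = (size pre + (F * (m + c)).*2)%N /\
    exists2 S : set R, produces U P S & (hausdorff_dist S C <= (G / 2 ^+ m)%:E)%E.
  have [N Nlt Ndig] := digits m.
  have [w sw] := compM (m + c)%N N Nlt F0.
  rewrite addnK => /preU cU.
  set pts := [seq _ | _ <- _] in cU.
  exists (pre ++ w); split; first by rewrite size_cat sw.
  exists [set ratr (point_value x) | x in [set` pts]]; first by exists pts.
  have B0 : 0 < 2 ^+ m :> R by rewrite exprn_gt0.
  pose X w t : R := (int_orbit d q N (m + c) m t w)%:R / 2 ^+ m.
  have ptE v : ratr (point_value (false,
      int_orbit d q N (m + c) m (m * l) v, (2 ^ m).-1)) = X v (m * l)%N.
    rewrite /= expr0 mul1r rmorphM /= fmorphV /= !ratr_nat prednK ?expn_gt0 //.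
    by rewrite natrX.
  have orbit_le v t : (int_orbit d q N (m + c) m t v <= 2 ^ m)%N.
    by case: t => // t; rewrite /= geq_minl.
  have X01 v t : X v t \in `[0, 1].
    rewrite in_itv /X /= divr_ge0 ?(ltW B0) //= ler_pdivrMr // mul1r -natrX ler_nat.
    exact: orbit_le.
  have Xtraj v x : x \in `[0, 1] ->
      `|X v (m * l)%N - trajectory phi (w_ v) (m * l) x| <= G / 2 ^+ m.
    move=> x01; rewrite /G mulrDl mul1r mulrAC.
    have e0 : 0 <= d.+1%:R / 2 ^+ m :> R by rewrite divr_ge0 // ltW.
    apply: le_trans (trajectory_approx (w := w_ v)
      rho01 e0 phi01 phi_rho (X01 v) _ x01) _.
      move=> t tl; rewrite phiE // /X /=; set n := int_orbit _ _ _ _ _ t v.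
      have dq : (digit v q t < q)%N by rewrite ltn_mod.
      apply: int_map_approx.
      + by move=> j jd; apply: Ndig.
      + exact: orbit_le.
      + rewrite -/(X v t) -(phiE (w_ v t)) //.
        by have := phi01 (w_ v t) (X v t); rewrite /= !in_itv /=; apply; exact: X01.
    rewrite lerD2r mulnC exprM -exprVn lerXn2r ?nnegrE ?exprn_ge0 //.
    - by move: rho01; lra.
    - by rewrite -div1r.
  (* A point of [C] is the end of a trajectory inside [C], whose itinerary is encoded by some [v].
     Conversely, each [v] is shadowed by a trajectory starting in [C], which stays there. *)
  apply: hausdorff_dist_le => [x Cx|_ [pt /= ptpts <-]].
  - have [u [y [Cy <-]]] := generated_trajectory_ex (m * l) genC Cx.
    have uq t : (t < m * l)%N -> (index (u t) (enum I) < q)%N.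
      by move=> _; rewrite /q cardE index_mem mem_enum.
    have [v vq vu] := digits_ex uq.
    have wu t : (t < m * l)%N -> w_ v t = u t.
      by move=> tl; rewrite /w_ vu // nth_index ?mem_enum.
    exists (X v (m * l)%N).
      exists (false, int_orbit d q N (m + c) m (m * l) v, (2 ^ m).-1).
        by rewrite /= map_f // mem_iota.
      exact: ptE.
    by rewrite -(eq_trajectory _ _ wu) distrC Xtraj //; exact: C01.
  - move: ptpts => /mapP[v _ ->]; have [y Cy] := Cn0; rewrite ptE.
    exists (trajectory phi (w_ v) (m * l) y); first exact: generated_trajectory.
    by rewrite Xtraj //; exact: C01.
pose c1 := (Num.truncn G).+1.
have Gc1 : G < 2 ^+ c1 by rewrite (lt_trans _ (ltn_exp2_natr _)) // truncnS_gt.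
(* The length is at most [size pre + F.*2 * (c1 + 1 + c) + F.*2 * L]; since [L >= 1], the constant
   terms are absorbed into multiples of [L]. *)
exists ((size pre)%:R + (F.*2)%:R * (c1 + 1 + c)%:R + F.*2%:R).
  by rewrite ltr_wpDl // ltr0n double_gt0.
near=> eps.
have eps0 : 0 < eps by near: eps; exact: nbhs_right_gt.
have eps2 : eps <= 1 / 2 by near: eps; apply: nbhs_right_le; lra.
pose L := log2 eps^-1.
have L1 : 1 <= L.
  have -> : 1 = log2 2 :> R by rewrite -[2]expr1 log2_exp.
  rewrite ler_log2 ?posrE ?invr_gt0 //.
  by rewrite -[2]invrK lef_pV2 ?posrE ?invr_gt0 // -div1r.
(* The factor 2^c1 beats [G], and the exponent [1 + Num.truncn L] exceeds [L], so that
   [G / 2 ^+ m < eps]. *)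
set m := (c1 + 1 + Num.truncn L)%N.
have [P [sP [S PS hS]]] := approx m.
have : (distortion_complexity U C eps <= (size P)%:R%:E)%E.
  apply: ereal_inf_lbound; exists P => //; exists S => //.
  apply: le_lt_trans hS _; rewrite lte_fin ltr_pdivrMr ?exprn_gt0 //.
  rewrite (lt_le_trans Gc1) // /m -addnA exprD mulrCA ler_peMr ?exprn_ge0 //.
  rewrite -ler_pdivrMl // mulr1 -ler_log2 ?posrE ?invr_gt0 ?exprn_gt0 //.
  rewrite log2_exp -/L add1n ltW // truncnS_gt //.
move/le_trans; apply; rewrite lee_fin sP -/L doubleMl natrD natrM.
rewrite (_ : m + c = c1 + 1 + c + Num.truncn L)%N; last by rewrite /m; lia.
rewrite [X in _ * X]natrD.
have tL : (Num.truncn L)%:R <= L by rewrite truncn_le // (le_trans ler01).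
rewrite mulrDr !mulrDl addrA; apply: lerD.
  by rewrite -mulrDl ler_peMr // addr_ge0 // mulr_ge0.
by rewrite ler_wpM2l.
Unshelve. all: by end_near.
Qed.

End UpperBound.

(** * Counting programs *)

Lemma step_iter_fixed (M : turing_machine) n c c' :
  iter n (obind (@step M)) (Some c) = Some c' -> step c = None -> c = c'.
Proof.
case: n => [[]|n] //; rewrite iterSr /= => + cN; rewrite cN.
by rewrite (_ : iter _ _ _ = None) //; elim: n => //= n ->.
Qed.

Lemma computes_functional (M : turing_machine) w v v' :
  computes M w v -> computes M w v' -> v = v'.
Proof.
move=> [n [c [cn cN <-]]] [m [c' [cm c'N <-]]].
wlog nm : n m c c' cn cm cN c'N / (n <= m)%N => [H|].
  case/orP: (leq_total n m) => nm; first exact: (H n m c c').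
  by apply/esym/(H m n c' c).
by move: cm; rewrite -(subnK nm) iterD cn => /step_iter_fixed/(_ cN) ->.
Qed.

Lemma produces_functional (R : realType) U P (F F' : set R) :
  produces U P F -> produces U P F' -> F = F'.
Proof.
move=> [l Ul ->] [l' Ul' ->].
by rewrite (list_word_inj (computes_functional Ul Ul')).
Qed.

(** The bits of [w], lowest first, topped by a 1 that marks the length: words of different lengths
    get different indices. *)
Definition word_index (w : seq bool) : nat :=
  foldr (fun (b : bool) n => (n.*2 + b)%N) 1%N w.

Lemma word_index_gt0 w : (0 < word_index w)%N.
Proof. by elim: w => //= b w; lia. Qed.

Lemma word_index_lt w : (word_index w < 2 ^ (size w).+1)%N.
Proof.
elim: w => //= b w; rewrite [X in (_ < X)%N -> _]expnS !expnS; case: b; lia.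
Qed.

Lemma word_index_inj : injective word_index.
Proof.
elim=> [|b w IHw] [|b' w'] //=.
- by have := word_index_gt0 w'; case: b'; lia.
- by have := word_index_gt0 w; case: b; lia.
- move=> ww'; have bb' : b = b' by case: b b' ww' => -[] //; lia.
  by rewrite bb' (IHw w') //; move: ww'; rewrite bb'; lia.
Qed.

(** * Existence of the generated set *)

Section Attractors.
Variables (R : realType) (I : finType) (phi : I -> R -> R) (K0 : set R).
Hypotheses (ifs_phi : is_ifs phi) (K0_compact : compact K0)
  (K0_01 : K0 `<=` `[0, 1])
  (phi_cont : forall i, continuous (phi i))
  (phi_K0 : forall i, set_fun K0 K0 (phi i)).

Fixpoint attractor_step (n : nat) : set R :=
  if n is m.+1 then \bigcup_(i in [set: I]) (phi i @` attractor_step m) else K0.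

Definition attractor : set R := \bigcap_n attractor_step n.

Lemma attractor_step_sub n : attractor_step n `<=` K0.
Proof.
elim: n => //= n IHn _ [i _ [x /IHn Kx <-]]; exact: phi_K0.
Qed.

Lemma attractor_step_compact n : compact (attractor_step n).
Proof.
elim: n => //= n IHn.
rewrite (_ : \bigcup_(i in _) _ =
    \big[setU/set0]_(i <- enum I) (phi i @` attractor_step n)).
  apply: bigsetU_compact => i _; apply: continuous_compact => //.
  exact/continuous_subspaceT/phi_cont.
rewrite -bigcup_seq; apply/seteqP; split=> x [i _ ix]; exists i => //=.
by rewrite mem_enum.
Qed.

Lemma fixpoint_in_attractor i x : K0 x -> phi i x = x -> attractor x.
Proof.
move=> Kx fx n _; elim: n => //= n IHn; exists i => //; exists x => //.
Qed.

(** Disjoint images and injectivity make the preimage of a point unique. The preimages found at all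
    levels therefore coincide, and this common point lies in the attractor. *)
Lemma attractor_generated : attractor !=set0 -> generated_by phi attractor.
Proof.
have [_ _ inj _ disj] := ifs_phi => A0.
have AK : attractor `<=` K0 by move=> x /(_ 0%N); exact.
split => //.
- apply: (subclosed_compact _ K0_compact AK); apply: closed_bigI => n _.
  apply: compact_closed; [exact: norm_hausdorff|exact: attractor_step_compact].
- by move=> x /AK /K0_01.
apply/seteqP; split => [x Ax|x [i _ [y Ay <-]]].
  have [i _ [y Ky yx]] := Ax 1%N Logic.I.
  exists i => //; exists y => // n _.
  have [j _ [z Kz zx]] := Ax n.+1 Logic.I.
  have z01 := K0_01 (@attractor_step_sub n _ Kz).
  have y01 := K0_01 Ky.
  have ij : j = i.
    apply: disj => //; exists x; split; [by exists z|by exists y].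
  move: zx; rewrite ij -yx => /(inj i z y); rewrite !inE => <- //.
case=> [|n] _; last by exists i => //; exists y => //; exact: Ay.
exact/phi_K0/AK.
Qed.

End Attractors.

(** * A one-parameter family and the lower bound *)

Section LowerBound.
Variable R : realType.

(* The largest point of the attractor is the fixed point [t] of the second
   map, so the attractor determines the real parameter [t]. *)
Definition quarter_system (t : R) (b : bool) (x : R) : R :=
  x / 4 + b%:R * (3 / 4 * t).

Lemma quarter_systemT t x : quarter_system t true x = x / 4 + 3 / 4 * t.
Proof. by rewrite /quarter_system mul1r. Qed.

Lemma quarter_systemF t x : quarter_system t false x = x / 4.
Proof. by rewrite /quarter_system mul0r addr0. Qed.

Let quarterE := (quarter_systemT, quarter_systemF).

Lemma quarter_system_polynomial t : polynomial_system (quarter_system t).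
Proof.
move=> b; exists ((1 / 4) *: 'X + (b%:R * (3 / 4 * t))%:P) => x _.
by rewrite hornerD hornerZ hornerX hornerC /quarter_system; field.
Qed.

(** The images of [0, 1] are [0, 1/4] and [3t/4, 3t/4 + 1/4]: they are disjoint for t > 1/3, and the
    second lies in [0, 1] for 0 <= t <= 1. *)
Lemma quarter_system_ifs t : 2 / 3 <= t <= 1 -> is_ifs (quarter_system t).
Proof.
move=> /andP[t0 t1]; split.
- by rewrite card_bool.
- move=> b x; rewrite /= !in_itv /= => /andP[? ?].
  by apply/andP; split; case: b; rewrite quarterE; lra.
- by case=> x y _ _; rewrite !quarterE; lra.
- exists (1 / 4); first by apply/andP; split; lra.
  move=> b x y _ _; rewrite /quarter_system.
  have -> : x / 4 + b%:R * (3 / 4 * t) - (y / 4 + b%:R * (3 / 4 * t)) =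
    1 / 4 * (x - y) by field.
  by rewrite normrM gtr0_norm //; lra.
- move=> i j _ _ [_ [[x /= + <-] [y /= +]]].
  rewrite !in_itv /= => /andP[? ?] /andP[? ?].
  by case: i; case: j => //=; rewrite !quarterE; lra.
Qed.

Lemma quarter_attractor t : 2 / 3 <= t <= 1 ->
  exists C, [/\ generated_by (quarter_system t) C, C t & C `<=` [set x | x <= t]].
Proof.
(* [0, t] is invariant; starting the construction from it makes [t] an upper bound of the
   attractor. *)
move=> t01; have [t0 t1] := andP t01; pose K := `[0, t]%classic : set R.
have Kt : K t by rewrite /K /= in_itv /=; apply/andP; split; lra.
have K01 : K `<=` `[0, 1].
  by move=> x; rewrite /K /= !in_itv /= => /andP[? ?]; apply/andP; split; lra.
have phiK b : set_fun K K (quarter_system t b).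
  move=> x; rewrite /K /= !in_itv /= => /andP[? ?].
  by apply/andP; split; case: b; rewrite quarterE; lra.
have cont b : continuous (quarter_system t b).
  move=> x; apply: cvgD; last exact: cvg_cst.
  by apply: cvgMr_tmp; exact: cvg_id.
have Ct : attractor (quarter_system t) K t.
  by apply: (@fixpoint_in_attractor _ _ _ _ true) => //; rewrite quarterE; lra.
exists (attractor (quarter_system t) K); split => //.
  apply: attractor_generated => //; first exact: quarter_system_ifs.
    exact: segment_compact.
  by exists t.
by move=> x /(_ 0%N I); rewrite /= /K /= in_itv /= => /andP[].
Qed.

(* Borel-Cantelli: the [T n k] with [n] large have total length below 1/3. *)
Lemma avoid_small_sets (T : nat -> nat -> set R) (M : nat -> nat)
    (e : nat -> R) (theta A : R) :
    0 < theta < 1 -> 0 <= A -> (forall n, 0 <= e n) ->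
    (forall n, (M n)%:R * e n <= A * theta ^+ n) ->
    (forall n k t s, T n k t -> T n k s -> `|t - s| <= e n) ->
  exists n0, exists2 t : R, 2 / 3 <= t <= 1 &
    forall n k, (n0 <= n)%N -> (k < M n)%N -> ~ T n k t.
Proof.
move=> /andP[th0 th1] A0 e0 Me small.
have q0 : 0 < 1 - theta by rewrite subr_gt0.
(* The left side bounds the lengths summed over all scales from [n0] on; 1/3 is the length of
   [2/3, 1]. *)
have [n0 n0E] : exists n0, 2 * A / (1 - theta) * theta ^+ n0 < 1 / 3.
  have : (fun n => 2 * A / (1 - theta) * theta ^+ n) @ \oo --> (0 : R).
    by apply: cvg_geometric; rewrite gtr0_norm.
  move=> /cvgrPdist_lt/(_ (1 / 3)) /(_ ltac:(lra)) [l _ /(_ l (leqnn l)) /=].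
  by rewrite sub0r normrN => /(le_lt_trans (ler_norm _)); exists l.
exists n0; apply: contrapT => noT.
(* The sets [T n k] may fail to be measurable, so each is enclosed in an interval of length
   [2 * e n]. *)
have /boolp.choice[x xT] : forall nk : nat * nat, exists x : R,
    T nk.1 nk.2 `<=` `[x - e nk.1, x + e nk.1].
  move=> [n k] /=; have [[x Tx]|T0] := pselect (T n k !=set0); last first.
    by exists 0 => y Ty; case: T0; exists y.
  exists x => y Ty; rewrite /= in_itv /=.
  have := small _ _ _ _ Tx Ty; rewrite ler_norml => /andP[? ?].
  by apply/andP; split; lra.
pose J n k := `[x (n, k) - e n, x (n, k) + e n]%classic : set R.
pose B n := \big[setU/set0]_(k < M (n0 + n)%N) J (n0 + n)%N k.
have mB n : measurable (B n).
  by apply: bigsetU_measurable => k _; exact: measurable_itv.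
have cover : `[2 / 3, 1]%classic `<=` \bigcup_n B n.
  move=> t; rewrite /= in_itv /= => t01; apply: contrapT => tB.
  apply: noT; exists t => // n k n0n kM Tt; apply: tB.
  exists (n - n0)%N => //; rewrite /B subnKC // -bigcup_mkord; exists k => //.
  exact: (xT (n, k)).
have muB n : (lebesgue_measure (B n) <= (2 * A * theta ^+ (n0 + n))%:E)%E.
  apply: le_trans
    (content_subadditive lebesgue_measure _ (mB n) (@subset_refl _ _)) _.
    by move=> k _; exact: measurable_itv.
  apply: (@le_trans _ _ (\sum_(k < M (n0 + n)%N) (2 * e (n0 + n)%N)%:E)).
    apply: lee_sum => k _; rewrite [X in (X <= _)%E]lebesgue_measure_itv /=.
    case: ifP => _; last by rewrite lee_fin mulr_ge0.
    by rewrite -EFinB lee_fin; lra.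
  rewrite sumEFin lee_fin sumr_const card_ord -mulr_natr.
  by have := Me (n0 + n)%N; lra.
have := measure_sigma_subadditive lebesgue_measure mB (measurable_itv _) cover.
rewrite [X in (X <= _)%E]lebesgue_measure_itv /= lte_fin.
rewrite (_ : (2 / 3 < 1 :> R)); last by lra.
apply/negP; rewrite -ltNge.
apply: (@le_lt_trans _ _ (2 * A / (1 - theta) * theta ^+ n0)%:E); last first.
  by rewrite -EFinB lte_fin; lra.
apply: lime_le; first by apply: is_cvg_nneseries => *; exact: measure_ge0.
apply: nearW => N.
apply: (@le_trans _ _ (\sum_(0 <= n < N) (2 * A * theta ^+ (n0 + n))%:E)).
  by apply: lee_sum => n _.
rewrite sumEFin lee_fin.
have -> : \sum_(0 <= n < N) 2 * A * theta ^+ (n0 + n) =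
    2 * A / (1 - theta) * theta ^+ n0 * (1 - theta ^+ N).
  elim: N => [|N IHN]; first by rewrite big_geq // expr0 subrr mulr0.
  by rewrite big_nat_recr //= IHN exprD exprS; field; rewrite gt_eqF.
rewrite ler_piMr ?mulr_ge0 ?invr_ge0 ?exprn_ge0 ?(ltW th0) ?(ltW q0) //.
by rewrite lerBlDr lerDl exprn_ge0 // ltW.
Qed.

End LowerBound.

Lemma complexity_lower_bound (R : realType) (U : turing_machine) (delta : R) :
  0 < delta ->
  exists (I : finType) (phi : I -> R -> R) (C : set R),
    [/\ is_ifs phi, polynomial_system phi, generated_by phi C &
      \forall eps \near 0^'+,
        (((1 - delta) * log2 eps^-1)%:E <= distortion_complexity U C eps)%E].
Proof.
(* Lowering [delta] strengthens the bound and keeps [1 - dl] positive. *)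
move=> delta0; pose dl := Num.min delta (1 / 2).
have dl0 : 0 < dl by rewrite lt_min delta0; lra.
have dl2 : dl <= 1 / 2 by rewrite ge_min lexx orbT.
have dld : dl <= delta by rewrite ge_min lexx.
have dl1 : 0 <= 1 - dl by lra.
pose theta : R := 2 `^ (- dl).
(* The factor [n.+1] covers all [eps] whose logarithm lies between [n] and [n.+1]. *)
pose S n := Num.truncn ((1 - dl) * n.+1%:R).
(* Parameters that the program of index [k] reveals: the largest point of its output is within 2^-n
   of [t]. *)
pose T n k := [set t : R | exists P F, [/\ word_index P = k, produces U P F,
  exists2 f, F f & `|t - f| < (2 ^+ n)^-1 & forall f, F f -> f < t + (2 ^+ n)^-1]].
have theta01 : 0 < theta < 1.
  rewrite powR_gt0 //= /theta /powR gt_eqF // expR_lt1 mulNr oppr_lt0.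
  by rewrite mulr_gt0 // ln_gt0 // ltr1n.
have S_le n : (S n)%:R <= (1 - dl) * n.+1%:R.
  by rewrite truncn_le mulr_ge0 //; lra.
(* The total is at most 2 * 2^((1 - dl)(n + 1)) * 2 / 2^n = 4 * 2^(1 - dl) * [theta ^+ n], whence
   the constant 8. *)
have [||||n0 [t t01 avoid]] := @avoid_small_sets R T (fun n => (2 ^ (S n).+1)%N)
    (fun n => 2 / 2 ^+ n) theta 8 theta01.
- by [].
- by move=> n; rewrite divr_ge0.
- move=> n; rewrite natrX exprS -mulrA [X in 2 * X]mulrA.
  have -> : theta ^+ n = 2 `^ (- dl * n%:R) by rewrite powRrM powR_mulrn ?powR_ge0.
  rewrite -!powR_mulrn //.
  apply: (@le_trans _ _ (2 * (2 `^ ((1 - dl) * n.+1%:R) * 2 / 2 `^ n%:R))).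
    rewrite ler_pM2l // ler_pM2r ?invr_gt0 ?powR_gt0 // ler_pM2r //.
    by rewrite ler_powR ?ler1n.
  rewrite -powRN mulrAC -powRD; last by apply/implyP; rewrite pnatr_eq0.
  have -> : (1 - dl) * n.+1%:R - n%:R = (1 - dl) + - dl * n%:R.
    by rewrite -natr1; ring.
  rewrite powRD; last by apply/implyP; rewrite pnatr_eq0.
  have c2 : 2 `^ (1 - dl) <= 2 :> R.
    by rewrite -[leRHS]powRr1 // ler_powR //; lra.
  have b0 : 0 <= 2 `^ (- dl * n%:R) :> R by rewrite powR_ge0.
  have := ler_wpM2r b0 c2.
  by move: (2 `^ (1 - dl)) (2 `^ (- dl * n%:R)) => c b; lra.
(* Both parameters come from the same program, hence from the same set; each is within 2^-n of its
   maximum, which gives [2 / 2 ^+ n]. *)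
- move=> n k s s' [P [F [Pk PF [f Ff sf] Fs]]] [P' [F' [P'k PF' [f' Ff' sf'] Fs']]].
  move: Pk; rewrite -P'k => /word_index_inj PP'; rewrite PP' in PF.
  rewrite (produces_functional PF PF') in Ff Fs.
  have := Fs f' Ff'; have := Fs' f Ff; move: sf sf'; rewrite !ltr_norml ler_norml.
  by move=> /andP[? ?] /andP[? ?] ? ?; apply/andP; split; lra.
have [C [genC Ct Cle]] := quarter_attractor t01.
exists bool, (quarter_system t), C; split => //.
- exact: quarter_system_ifs.
- exact: quarter_system_polynomial.
near=> eps.
have eps0 : 0 < eps by near: eps; exact: nbhs_right_gt.
have eps1 : eps <= (2 ^+ n0)^-1.
  by near: eps; apply: nbhs_right_le; rewrite invr_gt0 exprn_gt0.
pose L := log2 eps^-1.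
have Ln0 : n0%:R <= L.
  rewrite -(log2_exp R n0) ler_log2 ?posrE ?invr_gt0 ?exprn_gt0 //.
  by rewrite -[_ ^+ _]invrK lef_pV2 ?posrE ?invr_gt0 ?exprn_gt0.
have L0 : 0 <= L by rewrite (le_trans _ Ln0).
rewrite leNgt; apply/negP => /ereal_inf_lt[_ [P [F PF FC] <-]].
rewrite lte_fin -/L => sizeP.
pose n := Num.truncn L.
have nL : n%:R <= L by rewrite truncn_le.
have Ln : L < n.+1%:R by rewrite truncnS_gt.
have epsn : eps <= (2 ^+ n)^-1.
  rewrite -[eps]invrK lef_pV2 ?posrE ?invr_gt0 ?exprn_gt0 //.
  by rewrite -ler_log2 ?posrE ?invr_gt0 ?exprn_gt0 // log2_exp.
have [FCt CF] := hausdorff_dist_lt FC.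
have n0n : (n0 <= n)%N by rewrite truncn_ge_nat.
(* A program violating the bound has length at most [S n], so its index is among those avoided by
   [t]. *)
apply: (avoid n (word_index P) n0n).
  rewrite (leq_trans (word_index_lt P)) // leq_exp2l // ltnS truncn_ge_nat.
    apply: le_trans (ltW sizeP) _; apply: (@le_trans _ _ ((1 - dl) * L)).
      by apply: ler_wpM2r => //; apply: lerB.
    by apply: ler_wpM2l => //; exact: ltW.
  by rewrite mulr_ge0.
exists P, F; split => //.
  by have [f Ff tf] := FCt t Ct; exists f => //; exact: lt_le_trans tf epsn.
(* Each point of [F] is close to a point of [C], and these are at most [t]. *)
move=> f /CF[x /Cle /= xt]; rewrite ltr_norml => /andP[_ fx].
rewrite -ltrBlDl; apply: lt_le_trans epsn; apply: le_lt_trans fx.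
exact: lerB.
Unshelve. all: by end_near.
Qed.

Theorem theorem2p1 (R : realType) (U : turing_machine) (hU : universal U) :
  (forall (I : finType) (phi : I -> R -> R) (C : set R),
     is_ifs phi -> polynomial_system phi -> generated_by phi C ->
     exists2 K : R, 0 < K &
       \forall eps \near 0^'+,
         (distortion_complexity U C eps <= (K * log2 eps^-1)%:E)%E)
  /\
  (forall delta : R, 0 < delta ->
     exists (I : finType) (phi : I -> R -> R) (C : set R),
       [/\ is_ifs phi, polynomial_system phi, generated_by phi C &
         \forall eps \near 0^'+,
           (((1 - delta) * log2 eps^-1)%:E <= distortion_complexity U C eps)%E]).
Proof.
split=> [I phi C ifs_phi poly_phi gen_C|delta].
  exact: (complexity_upper_bound hU ifs_phi poly_phi gen_C).
exact: complexity_lower_bound.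
Qed.
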